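(* Let $X$ be a complete median space of finite rank and let $\Gamma$ be a finitely generated group of elliptic isometries of $X$ (each element of $\Gamma$ has bounded orbits). Then $\Gamma\curvearrowright X$ has a finite orbit and, if $X$ is connected, a global fixed point.
   Context: A median space is a metric space $(X,d)$ such that for all $x,y,z$ the set $I(x,y)\cap I(y,z)\cap I(z,x)$ is a single point, where $I(x,y)=\{z:d(x,z)+d(z,y)=d(x,y)\}$. A subset is convex if it contains $I(x,y)$ whenever it contains $x,y$; a halfspace is a nonempty proper convex subset with convex complement. The rank of $X$ is the maximal cardinality of a set of pairwise transverse halfspaces, where $\mathfrak h,\mathfrak k$ are transverse if $\mathfrak h\cap\mathfrak k$, $\mathfrak h\cap\mathfrak k^*$, $\mathfrak h^*\cap\mathfrak k$, $\mathfrak h^*\cap\mathfrak k^*$ are all nonempty ($^*$ denotes complement). *)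

(* Defs.v *)
From Stdlib Require Import Reals List.
Open Scope R_scope.

Section Median.
Variables (X : Type) (d : X -> X -> R).

Definition is_metric : Prop :=
  (forall x y, 0 <= d x y) /\ (forall x y, d x y = 0 <-> x = y) /\
  (forall x y, d x y = d y x) /\ (forall x y z, d x z <= d x y + d y z).

Definition interval (x y : X) : X -> Prop := fun z => d x z + d z y = d x y.

Definition median_space : Prop :=
  is_metric /\
  forall x y z, exists m,
    (interval x y m /\ interval y z m /\ interval z x m) /\
    forall m', interval x y m' /\ interval y z m' /\ interval z x m' -> m' = m.

Definition convex (C : X -> Prop) : Prop :=
  forall x y, C x -> C y -> forall z, interval x y z -> C z.

Definition compl (C : X -> Prop) : X -> Prop := fun x => ~ C x.

Definition halfspace (h : X -> Prop) : Prop :=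
  (exists x, h x) /\ (exists x, ~ h x) /\ convex h /\ convex (compl h).

Definition transverse (h k : X -> Prop) : Prop :=
  (exists x, h x /\ k x) /\ (exists x, h x /\ compl k x) /\
  (exists x, compl h x /\ k x) /\ (exists x, compl h x /\ compl k x).

(* rank <= n : every family of m pairwise transverse halfspaces has m <= n.
   (Pairwise transverse halfspaces are automatically pairwise distinct,
   since no halfspace is transverse to itself.) *)
Definition rank_le (n : nat) : Prop :=
  forall (m : nat) (H : nat -> X -> Prop),
    (forall i, (i < m)%nat -> halfspace (H i)) ->
    (forall i j, (i < m)%nat -> (j < m)%nat -> i <> j -> transverse (H i) (H j)) ->
    (m <= n)%nat.

Definition finite_rank : Prop := exists n, rank_le n.

Definition cauchy (u : nat -> X) : Prop :=
  forall eps, 0 < eps -> exists N, forall p q, (N <= p)%nat -> (N <= q)%nat ->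
    d (u p) (u q) < eps.

Definition converges_to (u : nat -> X) (l : X) : Prop :=
  forall eps, 0 < eps -> exists N, forall p, (N <= p)%nat -> d (u p) l < eps.

Definition complete : Prop := forall u, cauchy u -> exists l, converges_to u l.

Definition open_set (U : X -> Prop) : Prop :=
  forall x, U x -> exists eps, 0 < eps /\ forall y, d x y < eps -> U y.

Definition connected : Prop :=
  forall U, open_set U -> open_set (compl U) -> (forall x, U x) \/ (forall x, ~ U x).

Definition isometry (f : X -> X) : Prop := forall x y, d (f x) (f y) = d x y.

Definition good_generator (p : (X -> X) * (X -> X)) : Prop :=
  isometry (fst p) /\ isometry (snd p) /\
  (forall x, fst p (snd p x) = x) /\ (forall x, snd p (fst p x) = x).

Inductive in_group (S : list ((X -> X) * (X -> X))) : (X -> X) -> Prop :=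
| in_group_id : in_group S (fun x => x)
| in_group_l : forall p g, In p S -> in_group S g -> in_group S (fun x => fst p (g x))
| in_group_r : forall p g, In p S -> in_group S g -> in_group S (fun x => snd p (g x)).

Definition elliptic (g : X -> X) : Prop :=
  forall x, exists B, forall n : nat, d x (Nat.iter n g x) <= B.

Definition finite_orbit (S : list ((X -> X) * (X -> X))) (x : X) : Prop :=
  exists l : list X, forall g, in_group S g -> In (g x) l.

End Median.
Arguments median_space {X}. Arguments complete {X}. Arguments finite_rank {X}.
Arguments good_generator {X}. Arguments in_group {X}. Arguments elliptic {X}.
Arguments finite_orbit {X}. Arguments connected {X}. Arguments rank_le {X}.
Arguments halfspace {X}. Arguments transverse {X}. Arguments convex {X}. Arguments interval {X}. Arguments isometry {X}.

(* Main.v *)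
(** Disjoint convex sets in a median space are separated by halfspaces, so identities between
    medians can be checked on halfspaces, where the median is the majority vote.

    Finite rank enters twice.  By a Caratheodory argument, hulls of small neighbourhoods of a
    convex set stay close to it, so convex sets at positive distance are separated by halfspaces
    containing neighbourhoods of them.  Moreover the two ends of a chain of 2r+1 halfspaces are
    at positive distance.  Hence if an isometry g maps a halfspace h strictly inside itself, a
    power of g moves points linearly far away, and g is not elliptic.

    If the orbit of x0 were unbounded, then a pigeonhole argument along an orbit path from x0 to
    g x0 would give more than r translates of one halfspace separating x0 from g x0 with the
    same orientation; two of them are nested, a contradiction.  So there is a minimal closed
    convex bounded invariant set C.  Let h be a halfspace such that both h and its complement
    have interior in C.  By minimality and Helly some translate of h is disjoint from h, and
    some translate of the complement is disjoint from the complement; as no halfspace is mapped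
    strictly inside itself, h is mapped to its complement, and h is open and closed in C.  Two
    such halfspaces are equal, complementary or transverse, so at most r of them separate the
    points of C, which is therefore finite; if X is connected there are none and C is a point. *)

Require Import Defs.
From Stdlib Require Import Reals List Lra Lia Sorted Classical ClassicalEpsilon.
From mathcomp Require classical_sets.
Set Bullet Behavior "Strict Subproofs".

(** * Zorn's lemma, finite sums and sorted lists *)

(** For a preorder, maximality is up to equivalence; inclusions of predicates can then be used
    without extensionality. *)
Lemma zorn (T : Type) (R : T -> T -> Prop) (t0 : T) :
  (forall t, R t t) -> (forall r s t, R r s -> R s t -> R r t) ->
  (forall A : T -> Prop, (forall s t, A s -> A t -> R s t \/ R t s) ->
    exists t, forall s, A s -> R s t) ->
  exists t, forall s, R t s -> R s t.
Proof.
  intros Hr Ht Hc.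
  set (Rb := fun s t => if excluded_middle_informative (R s t) then true else false).
  assert (E : forall s t, Rb s t = true <-> R s t).
  { intros s t; unfold Rb; destruct excluded_middle_informative; now split. }
  destruct (@classical_sets.ZL_preorder T t0 Rb) as [t Hmax].
  - intros t; now apply E.
  - intros r s t H1 H2; apply E; apply E in H1, H2; eauto.
  - intros A HA; destruct (Hc A) as [t Hub].
    + intros s t As At; destruct (HA s t As At) as [H|H]; apply E in H; auto.
    + exists t; intros s As; apply E; auto.
  - exists t; intros s Hs; apply E, Hmax, E, Hs.
Qed.

Lemma iter_mul (T : Type) (f : T -> T) a b x :
  Nat.iter a (Nat.iter b f) x = Nat.iter (a * b) f x.
Proof. induction a as [|a IH]; simpl; auto; now rewrite IH, Nat.iter_add. Qed.

Lemma iter_cancel (T : Type) (f f' : T -> T) n x :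
  (forall x, f' (f x) = x) -> Nat.iter n f' (Nat.iter n f x) = x.
Proof.
  intros H; induction n as [|n IH]; simpl; auto.
  now rewrite <- Nat.iter_succ, Nat.iter_succ_r, H.
Qed.

Definition sum {T : Type} (f : T -> R) (l : list T) : R := fold_right (fun t s => f t + s) 0 l.
Definition decb (P : Prop) : bool := if excluded_middle_informative P then true else false.
Definition ind (P : Prop) : R := if decb P then 1 else 0.

Lemma decb_true P : decb P = true <-> P.
Proof. unfold decb; destruct excluded_middle_informative; now split. Qed.

Lemma sum_le {T : Type} (f g : T -> R) l :
  (forall t, In t l -> f t <= g t) -> sum f l <= sum g l.
Proof.
  induction l as [|a l IH]; simpl; intros H; [lra|].
  apply Rplus_le_compat; auto.
Qed.

Lemma sum_plus {T : Type} (f g : T -> R) l : sum (fun t => f t + g t) l = sum f l + sum g l.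
Proof. induction l as [|a l IH]; simpl; lra. Qed.

Lemma sum_scal {T : Type} (f : T -> R) c l : sum (fun t => f t * c) l = sum f l * c.
Proof. induction l as [|a l IH]; simpl; lra. Qed.

Lemma sum_swap {T U : Type} (f : T -> U -> R) l m :
  sum (fun t => sum (f t) m) l = sum (fun u => sum (fun t => f t u) l) m.
Proof.
  induction l as [|a l IH]; simpl.
  - induction m as [|b m IHm]; simpl; lra.
  - rewrite IH, <- sum_plus; reflexivity.
Qed.

Lemma sum_filter {T : Type} (P : T -> Prop) (f : T -> R) l :
  sum f (filter (fun t => decb (P t)) l) = sum (fun t => ind (P t) * f t) l.
Proof.
  induction l as [|a l IH]; simpl; auto; unfold ind at 1.
  destruct (decb (P a)); simpl; rewrite IH; lra.
Qed.

Lemma sum_ind {T : Type} (P : T -> Prop) l :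
  sum (fun t => ind (P t)) l = INR (length (filter (fun t => decb (P t)) l)).
Proof.
  induction l as [|a l IH]; simpl; auto; unfold ind at 1.
  destruct (decb (P a)); rewrite IH; [|lra].
  change (length (a :: ?m)) with (S (length m)); rewrite <- Rplus_comm, <- S_INR; reflexivity.
Qed.

(** After exchanging the sums, each [t] is counted at least once, for the value [k t]; repetitions
    in [m] only add nonnegative terms. *)
Lemma sum_classes {T U : Type} (k : T -> U) (f : T -> R) l m :
  (forall t, In t l -> 0 <= f t) -> (forall t, In t l -> In (k t) m) ->
  sum f l <= sum (fun u => sum f (filter (fun t => decb (k t = u)) l)) m.
Proof.
  intros Hf Hk.
  replace (sum (fun u => sum f (filter (fun t => decb (k t = u)) l)) m)
    with (sum (fun t => sum (fun u => ind (k t = u) * f t) m) l).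
  - apply sum_le; intros t Ht; specialize (Hf t Ht); specialize (Hk t Ht).
    assert (P : forall u, 0 <= ind (k t = u) * f t)
      by (intros u; unfold ind; destruct (decb (k t = u)); lra).
    induction m as [|u m IH]; simpl in *; [easy|].
    assert (0 <= sum (fun u => ind (k t = u) * f t) m)
      by (clear - P; induction m; simpl; [lra|]; specialize (P a); lra).
    destruct Hk as [->|Hk]; [|specialize (IH Hk); specialize (P u); lra].
    unfold ind at 1; rewrite (proj2 (decb_true (k t = k t)) eq_refl); lra.
  - rewrite sum_swap; clear; induction m as [|u m IH]; simpl; auto.
    now rewrite (sum_filter (fun t => k t = u) f l), IH.
Qed.

Lemma StronglySorted_filter {T : Type} (Q : T -> T -> Prop) p l :
  StronglySorted Q l -> StronglySorted Q (filter p l).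
Proof.
  induction 1 as [|a l Hl IH Ha]; simpl; [constructor|].
  destruct (p a); auto; constructor; auto.
  rewrite Forall_forall in *; intros x Hx; apply filter_In in Hx; now apply Ha.
Qed.

Lemma StronglySorted_nth {T : Type} (Q : T -> T -> Prop) l t0 :
  StronglySorted Q l -> forall i j, (i < j < length l)%nat -> Q (nth i l t0) (nth j l t0).
Proof.
  induction 1 as [|a l Hl IH Ha]; simpl; intros i j Hij; [lia|].
  destruct j as [|j]; [lia|]; destruct i as [|i].
  - rewrite Forall_forall in Ha; apply Ha, nth_In; lia.
  - apply IH; lia.
Qed.

Definition inverse {X : Type} (f f' : X -> X) : Prop :=
  (forall x, f' (f x) = x) /\ (forall x, f (f' x) = x).

(** * Intervals and medians *)

Section MedianSpace.
Variables (X : Type) (d : X -> X -> R).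
Hypothesis Hmed : median_space d.

Lemma dpos x y : 0 <= d x y. Proof. apply Hmed. Qed.
Lemma deq0 x y : d x y = 0 -> x = y. Proof. apply Hmed. Qed.
Lemma dxx x : d x x = 0. Proof. now apply Hmed. Qed.
Lemma dsym x y : d x y = d y x. Proof. apply Hmed. Qed.
Lemma dtri x y z : d x z <= d x y + d y z. Proof. apply Hmed. Qed.

Ltac dsat :=
  unfold interval in *;
  repeat match goal with
  | H : context [d ?a ?b] |- _ =>
    lazymatch goal with
    | _ : d a b = d b a |- _ => fail
    | _ : d b a = d a b |- _ => fail
    | _ => pose proof (dsym a b) end
  | |- context [d ?a ?b] =>
    lazymatch goal with
    | _ : d a b = d b a |- _ => fail
    | _ : d b a = d a b |- _ => fail
    | _ => pose proof (dsym a b) end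
  end.

Lemma interval_sym x y z : interval d x y z -> interval d y x z.
Proof. intros; dsat; lra. Qed.
Lemma interval_l x y : interval d x y x.
Proof. unfold interval; rewrite dxx; lra. Qed.
Lemma interval_r x y : interval d x y y.
Proof. unfold interval; rewrite dxx; lra. Qed.

Lemma interval_sub x y w z :
  interval d x y w -> interval d x w z -> interval d x y z /\ interval d z y w.
Proof.
  intros H1 H2; dsat; pose proof (dtri x z y); pose proof (dtri z w y); split; lra.
Qed.

Lemma interval_id x z : interval d x x z -> z = x.
Proof.
  unfold interval; intros H; rewrite dxx, (dsym z x) in H.
  pose proof (dpos x z); symmetry; apply deq0; lra.
Qed.

Lemma interval_anti x y z : interval d x y z -> interval d x z y -> y = z.
Proof.
  intros H1 H2; dsat; apply deq0; pose proof (dpos y z); lra.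
Qed.

Definition med x y z : X :=
  epsilon (inhabits x)
    (fun m => interval d x y m /\ interval d y z m /\ interval d z x m).

Lemma med_spec x y z :
  interval d x y (med x y z) /\ interval d y z (med x y z) /\ interval d z x (med x y z).
Proof.
  unfold med; apply epsilon_spec.
  destruct Hmed as [_ Hm]; destruct (Hm x y z) as [m [H _]]; now exists m.
Qed.

Lemma med_unique x y z m :
  interval d x y m -> interval d y z m -> interval d z x m -> m = med x y z.
Proof.
  intros H1 H2 H3; destruct Hmed as [_ Hm]; destruct (Hm x y z) as [m' [H U]].
  rewrite (U (med x y z) (med_spec x y z)); now apply U.
Qed.

(** The median is the gate of [z] in the interval from [a] to [b]. The medians [u], [v] of [z] with
    the two halves cut at [p] have with [z] a median [t] that lies between any two of [a], [b], [z],
    so [t] is [med a b z]; and it lies between [z] and [u], hence between [z] and [p]. *)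
Lemma med_gate a b z p :
  interval d a b p -> interval d z p (med a b z).
Proof.
  intros Hp.
  destruct (med_spec a p z) as [u1 [u2 u3]].
  destruct (med_spec b p z) as [v1 [v2 v3]].
  set (u := med a p z) in *; set (v := med b p z) in *.
  destruct (med_spec u v z) as [t1 [t2 t3]].
  set (t := med u v z) in *.
  destruct (interval_sub a b p u Hp u1) as [Hu1 Hu2].
  destruct (interval_sub b u p v (interval_sym _ _ _ Hu2) v1) as [Hv1 Hv2].
  assert (Ht : t = med a b z).
  { apply med_unique.
    - dsat; pose proof (dtri a u t); pose proof (dtri t v b); pose proof (dtri a t b); lra.
    - dsat; pose proof (dtri t v b); pose proof (dtri b t z); lra.
    - dsat; pose proof (dtri t u a); pose proof (dtri z t a); lra. }
  rewrite <- Ht. dsat.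
  pose proof (dtri t u p); pose proof (dtri t v p); pose proof (dtri z t p); lra.
Qed.

Lemma interval_convex a b : convex d (interval d a b).
Proof.
  intros x y Hx Hy z Hz.
  pose proof (med_gate a b z x Hx); pose proof (med_gate a b z y Hy).
  destruct (med_spec a b z) as [H1 _].
  replace z with (med a b z); [exact H1|].
  dsat; pose proof (dtri x (med a b z) y); pose proof (dpos (med a b z) z).
  apply deq0; lra.
Qed.

(** In the order based at [w], where the points below [x] are those between [w] and [x], the median
    is the meet of [x] and [y]. *)
Lemma med_glb w x y t :
  interval d w x t -> interval d w y t -> interval d w (med w x y) t.
Proof.
  intros H1 H2; pose proof (med_gate w x y t H1).
  destruct (med_spec w x y) as [M1 [M2 M3]].
  dsat; pose proof (dtri w t (med w x y)); lra.
Qed.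

(** The Peano axiom of interval spaces. In the order based at [z], the point [u] is below [a], [b]
    and [x], hence below [p] and [b], whose meet is [z]; so [u] is [z]. *)
Lemma peano x a b p z : interval d x a p -> interval d p b z ->
  exists c, interval d a b c /\ interval d x c z.
Proof.
  intros Hp Hz; exists (med a b z).
  destruct (med_spec a b z) as [c1 [c2 c3]]; split; [exact c1|].
  set (c := med a b z) in *.
  destruct (med_spec x c z) as [u1 [u2 u3]]; set (u := med x c z) in *.
  assert (ua : interval d z a u)
    by (apply (interval_sub z a c u); auto using interval_sym).
  assert (ub : interval d z b u)
    by (apply (interval_sub z b c u); auto using interval_sym).
  assert (uv : interval d z (med z x a) u) by (apply med_glb; auto).
  assert (vp : interval d z p (med z x a)).
  { replace (med z x a) with (med x a z); [apply med_gate; auto|].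
    destruct (med_spec x a z) as [? [? ?]]; apply med_unique; auto using interval_sym. }
  assert (up : interval d z p u) by (apply (interval_sub z p (med z x a) u); auto).
  assert (E : z = med z p b)
    by (apply med_unique; auto using interval_l, interval_r).
  assert (Hu : interval d z (med z p b) u) by (apply med_glb; auto).
  rewrite <- E in Hu; apply interval_id in Hu; now rewrite <- Hu.
Qed.

(** The Pasch axiom, with the order based at [t]: [u] is below [b] and [a'], whose meet is [t]. *)
Lemma pasch x a a' b b' : interval d a x b -> interval d b' x a' ->
  exists t, interval d a a' t /\ interval d b b' t.
Proof.
  intros Hb Ha; exists (med a a' b).
  destruct (med_spec a a' b) as [t1 [t2 t3]]; split; [exact t1|].
  set (t := med a a' b) in *.
  destruct (med_spec b b' t) as [u1 [u2 u3]]; set (u := med b b' t) in *.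
  assert (tx : interval d x a t /\ interval d x t b)
    by (split; dsat; pose proof (dtri a t x); pose proof (dtri t b x); lra).
  assert (ux : interval d t x u)
    by (apply (interval_sub t x b u); auto using interval_sym; apply interval_sym, tx).
  assert (ub : interval d t (med t b' x) u) by (apply med_glb; auto using interval_sym).
  assert (va : interval d t a' (med t b' x)).
  { replace (med t b' x) with (med b' x t); [apply med_gate; auto|].
    destruct (med_spec b' x t) as [? [? ?]]; apply med_unique; auto using interval_sym. }
  assert (ua : interval d t a' u) by (apply (interval_sub t a' (med t b' x) u); auto).
  assert (E : t = med t b a')
    by (apply med_unique; auto using interval_l, interval_r, interval_sym).
  assert (Hu : interval d t (med t b a') u) by (apply med_glb; auto).
  rewrite <- E in Hu; apply interval_id in Hu; now rewrite <- Hu.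
Qed.

(** * Separation of convex sets by halfspaces *)

(** For [A] convex and nonempty, this is the convex hull of [A] and [x]. *)
Definition join (A : X -> Prop) (x : X) : X -> Prop :=
  fun z => exists a, A a /\ interval d a x z.

Lemma join_convex A x : convex d A -> convex d (join A x).
Proof.
  intros HA p p' [a [Aa Hp]] [a' [Aa' Hp']] z Hz.
  destruct (peano x a' p p' z) as [c [c1 c2]]; auto using interval_sym.
  destruct (peano x a a' p c) as [e [e1 e2]]; auto using interval_sym.
  exists e; split; [exact (HA a a' Aa Aa' e e1)|].
  apply interval_sym, (interval_sub x e c z); auto.
Qed.

(** Zorn's lemma gives a maximal pair of disjoint convex sets containing [A0] and [B0]. If a point
    were in neither, joining it to either set would make that set meet the other, and the Pasch
    axiom would give a common point of the pair. *)
Lemma kakutani (A0 B0 : X -> Prop) :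
  convex d A0 -> convex d B0 -> (exists a, A0 a) -> (exists b, B0 b) ->
  (forall x, A0 x -> ~ B0 x) ->
  exists h, halfspace d h /\ (forall x, A0 x -> h x) /\ (forall x, B0 x -> ~ h x).
Proof.
  intros cA0 cB0 [a0 Ha0] [b0 Hb0] D0.
  set (T := {P : (X -> Prop) * (X -> Prop) |
    convex d (fst P) /\ convex d (snd P) /\ (forall x, A0 x -> fst P x) /\
    (forall x, B0 x -> snd P x) /\ (forall x, fst P x -> ~ snd P x)}).
  set (R := fun P Q : T => (forall x, fst (proj1_sig P) x -> fst (proj1_sig Q) x) /\
                           (forall x, snd (proj1_sig P) x -> snd (proj1_sig Q) x)).
  assert (Q0 : convex d A0 /\ convex d B0 /\ (forall x, A0 x -> A0 x) /\
    (forall x, B0 x -> B0 x) /\ (forall x, A0 x -> ~ B0 x)) by auto.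
  set (t0 := exist _ (A0, B0) Q0 : T).
  destruct (zorn T R t0) as [[[A B] [cA [cB [iA [iB D]]]]] Hmax]; simpl in *.
  - now split.
  - intros P Q S [H1 H2] [H3 H4]; split; auto.
  - intros C HC.
    (* Any two points of the union of a chain lie in one member; adding [D], an original set, covers
       the empty chain. *)
    assert (dir : forall (D : X -> Prop) (pr : T -> X -> Prop),
      (forall P x, D x -> pr P x) -> (forall x, pr t0 x -> D x) ->
      (forall P Q, R P Q -> forall x, pr P x -> pr Q x) ->
      forall x y, (D x \/ exists P, C P /\ pr P x) -> (D y \/ exists P, C P /\ pr P y) ->
      exists P, pr P x /\ pr P y /\ forall z, pr P z -> D z \/ exists P, C P /\ pr P z).
    { intros D pr H1 H2 H3 x y [Hx|[P [CP Px]]] [Hy|[Q [CQ Qy]]].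
      - exists t0; auto 8.
      - exists Q; eauto 8.
      - exists P; eauto 8.
      - destruct (HC P Q CP CQ) as [H|H]; [exists Q|exists P]; eauto 10. }
    set (A := fun x => A0 x \/ exists P, C P /\ fst (proj1_sig P) x).
    set (B := fun x => B0 x \/ exists P, C P /\ snd (proj1_sig P) x).
    assert (HA := dir A0 (fun P => fst (proj1_sig P))).
    assert (HB := dir B0 (fun P => snd (proj1_sig P))).
    specialize (HA ltac:(intros [P [? [? [? ?]]]]; auto) ltac:(auto) ltac:(intros P Q []; auto)).
    specialize (HB ltac:(intros [P [? [? [? [? ?]]]]]; auto) ltac:(auto) ltac:(intros P Q []; auto)).
    unshelve eexists (exist _ (A, B) _); simpl.
    + repeat split.
      * intros x y Ax Ay z Hz; destruct (HA x y Ax Ay) as [P [Px [Py K]]].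
        apply K; destruct P as [P [cP ?]]; simpl in *; exact (cP x y Px Py z Hz).
      * intros x y Ax Ay z Hz; destruct (HB x y Ax Ay) as [P [Px [Py K]]].
        apply K; destruct P as [P [cP [cP' ?]]]; simpl in *; exact (cP' x y Px Py z Hz).
      * intros; now left.
      * intros; now left.
      * intros x [Hx|[P [CP Px]]] [Hy|[Q [CQ Qy]]].
        -- now apply (D0 x).
        -- destruct Q as [Q [? [? [? [? DQ]]]]]; simpl in *; apply (DQ x); auto.
        -- destruct P as [P [? [? [? [? DP]]]]]; simpl in *; apply (DP x); auto.
        -- destruct (HC P Q CP CQ) as [[H1 H2]|[H1 H2]].
           ++ destruct Q as [Q [? [? [? [? DQ]]]]]; simpl in *; apply (DQ x); auto.
           ++ destruct P as [P [? [? [? [? DP]]]]]; simpl in *; apply (DP x); auto.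
    + intros P CP; split; simpl; intros x Hx; right; now exists P.
  - assert (cov : forall x, ~ A x -> B x).
    { intros x nA; apply NNPP; intros nB.
      assert (H1 : exists b, B b /\ join A x b).
      { apply NNPP; intros N.
        assert (Q : convex d (join A x) /\ convex d B /\ (forall y, A0 y -> join A x y) /\
          (forall y, B0 y -> B y) /\ (forall y, join A x y -> ~ B y)).
        { repeat split; auto using join_convex.
          - intros y Hy; exists y; split; [auto|apply interval_l].
          - intros y Hy HB; apply N; eauto. }
        destruct (Hmax (exist _ (join A x, B) Q)) as [H _].
        - split; simpl; auto; intros y Hy; exists y; split; [auto|apply interval_l].
        - apply nA, H; simpl; exists a0; split; [auto|apply interval_r]. }
      assert (H2 : exists a, A a /\ join B x a).
      { apply NNPP; intros N.
        assert (Q : convex d A /\ convex d (join B x) /\ (forall y, A0 y -> A y) /\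
          (forall y, B0 y -> join B x y) /\ (forall y, A y -> ~ join B x y)).
        { repeat split; auto using join_convex.
          - intros y Hy; exists y; split; [auto|apply interval_l].
          - intros y Hy HB; apply N; eauto. }
        destruct (Hmax (exist _ (A, join B x) Q)) as [_ H].
        - split; simpl; auto; intros y Hy; exists y; split; [auto|apply interval_l].
        - apply nB, H; simpl; exists b0; split; [auto|apply interval_r]. }
      destruct H1 as [b [Bb [a [Aa Hb]]]], H2 as [a' [Aa' [b' [Bb' Ha']]]].
      destruct (pasch x a a' b b' Hb Ha') as [t [t1 t2]].
      apply (D t); [exact (cA a a' Aa Aa' t t1)|exact (cB b b' Bb Bb' t t2)]. }
    exists A; repeat split; auto.
    + exists a0; auto.
    + exists b0; intros HA; apply (D b0); auto.
    + intros x y Hx Hy z Hz HA.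
      apply (D z HA), (cB x y); auto.
    + intros x Hx HA; apply (D x); auto.
Qed.

Lemma singleton_convex x : convex d (eq x).
Proof. intros y z <- <- t Ht; symmetry; now apply interval_id. Qed.

Lemma halfspace_ext x y : (forall h, halfspace d h -> h x -> h y) -> x = y.
Proof.
  intros H; apply NNPP; intros N.
  destruct (kakutani (eq x) (eq y)) as [h [Hh [h1 h2]]]; eauto using singleton_convex.
  - congruence.
  - apply (h2 y eq_refl), (H h Hh), h1; reflexivity.
Qed.

Lemma halfspace_compl h : halfspace d h -> halfspace d (fun x => ~ h x).
Proof.
  intros [[x Hx] [Hn [c1 c2]]]; repeat split; auto.
  - exists x; auto.
  - intros y z Hy Hz t Ht N; apply N, (c1 y z); auto; now apply NNPP.
Qed.

Lemma halfspace_interval h x y z :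
  halfspace d h -> interval d x y z -> h x -> h y -> h z.
Proof. intros [_ [_ [c1 c2]]] H Hx Hy; exact (c1 x y Hx Hy z H). Qed.

Lemma halfspace_interval' h x y z :
  halfspace d h -> interval d x y z -> h z -> h x \/ h y.
Proof.
  intros [_ [_ [c1 c2]]] H Hz; apply NNPP; intros N.
  apply (c2 x y) with z; unfold compl; tauto.
Qed.

Lemma halfspace_med h x y z : halfspace d h ->
  (h (med x y z) <-> (h x /\ h y) \/ (h y /\ h z) \/ (h z /\ h x)).
Proof.
  intros Hh; destruct (med_spec x y z) as [m1 [m2 m3]].
  pose proof (halfspace_interval h _ _ _ Hh m1).
  pose proof (halfspace_interval h _ _ _ Hh m2).
  pose proof (halfspace_interval h _ _ _ Hh m3).
  pose proof (halfspace_interval' h _ _ _ Hh m1).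
  pose proof (halfspace_interval' h _ _ _ Hh m2).
  pose proof (halfspace_interval' h _ _ _ Hh m3).
  tauto.
Qed.

Lemma interval_halfspace x y z :
  (forall h, halfspace d h -> h x -> h y -> h z) -> interval d x y z.
Proof.
  intros H; replace z with (med x y z); [apply med_spec|].
  symmetry; apply halfspace_ext; intros h Hh Hz; apply halfspace_med; auto.
  pose proof (H _ (halfspace_compl h Hh)); simpl in *.
  destruct (classic (h x)), (classic (h y)); tauto.
Qed.

Lemma med_lipschitz a b z z' : d (med a b z) (med a b z') <= d z z'.
Proof.
  destruct (med_spec a b z) as [q _], (med_spec a b z') as [q' _].
  pose proof (med_gate a b z _ q'); pose proof (med_gate a b z' _ q).
  dsat; pose proof (dtri z z' (med a b z')); pose proof (dtri z' z (med a b z)); lra.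
Qed.

(** * Gates and intersections of closed convex sets *)

Lemma med_swap x y z : med x y z = med y x z.
Proof. destruct (med_spec x y z) as [? [? ?]]; apply med_unique; auto using interval_sym. Qed.

Lemma med_rot x y z : med x y z = med y z x.
Proof. destruct (med_spec x y z) as [? [? ?]]; apply med_unique; auto using interval_sym. Qed.

(** As [z] is the median of [x], [y], [z], the endpoints can be replaced one at a time, each at the
    cost of its displacement. *)
Lemma interval_perturb x y z u v :
  interval d x y z -> d z (med u v z) <= d x u + d y v.
Proof.
  intros H; assert (E : z = med z y x).
  { apply med_unique; auto using interval_l, interval_r, interval_sym. }
  pose proof (med_lipschitz z y x u); pose proof (med_lipschitz z u y v).
  rewrite <- E in H0; rewrite (med_rot z y u), (med_swap y u z), <- med_rot in H0.
  rewrite (med_rot z u v) in H1.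
  pose proof (dtri z (med z u y) (med u v z)); lra.
Qed.

Definition closure (C : X -> Prop) : X -> Prop :=
  fun x => forall eps, 0 < eps -> exists v, C v /\ d x v < eps.
Definition closed (C : X -> Prop) : Prop := forall x, closure C x -> C x.

Lemma closure_sub C x : C x -> closure C x.
Proof. intros H eps He; exists x; rewrite dxx; auto. Qed.

Lemma closure_mono (C D : X -> Prop) x :
  (forall y, C y -> D y) -> closure C x -> closure D x.
Proof. intros H Hx eps He; destruct (Hx eps He) as [v [? ?]]; eauto. Qed.

Lemma closure_closed C : closed (closure C).
Proof.
  intros x Hx eps He; destruct (Hx (eps / 2)) as [v [Hv Hd]]; [lra|].
  destruct (Hv (eps / 2)) as [w [Hw Hd']]; [lra|].
  exists w; split; auto; pose proof (dtri x v w); lra.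
Qed.

Lemma closure_convex C : convex d C -> convex d (closure C).
Proof.
  intros HC x y Hx Hy z Hz eps He.
  destruct (Hx (eps / 2)) as [u [Hu Hd]]; [lra|].
  destruct (Hy (eps / 2)) as [v [Hv Hd']]; [lra|].
  exists (med u v z); split.
  - destruct (med_spec u v z) as [Hm _]; exact (HC u v Hu Hv _ Hm).
  - pose proof (interval_perturb x y z u v Hz); lra.
Qed.

Lemma interval_closed x y : closed (interval d x y).
Proof.
  intros z Hz; unfold interval; pose proof (dtri x z y).
  apply Rle_antisym; [|lra].
  apply Rle_plus_epsilon; intros eps He.
  destruct (Hz (eps / 2)) as [v [Hv Hd]]; [lra|]; dsat.
  pose proof (dtri x v z); pose proof (dtri z v y); lra.
Qed.

Lemma convex_and C D : convex d C -> convex d D -> convex d (fun x => C x /\ D x).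
Proof. intros HC HD x y [] [] z Hz; split; [apply (HC x y)|apply (HD x y)]; auto. Qed.

(** Three pairwise meeting convex sets share the median of points taken in the pairwise
    intersections; the induction absorbs [A] into [C]. *)
Lemma helly (l : list (X -> Prop)) : forall C : X -> Prop,
  convex d C -> (exists x, C x) -> (forall A, In A l -> convex d A) ->
  (forall A, In A l -> exists x, C x /\ A x) ->
  (forall A B, In A l -> In B l -> exists x, A x /\ B x) ->
  exists x, C x /\ forall A, In A l -> A x.
Proof.
  induction l as [|A l IH]; intros C cC neC cl HC Hl; simpl in *.
  - destruct neC as [x Hx]; exists x; tauto.
  - destruct (IH (fun x => C x /\ A x)) as [x [[Cx Ax] Hx]]; auto.
    + apply convex_and; auto.
    + intros B HB.
      destruct (HC A (or_introl eq_refl)) as [x [Cx Ax]].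
      destruct (HC B (or_intror HB)) as [y [Cy By]].
      destruct (Hl A B) as [z [Az Bz]]; auto.
      destruct (med_spec x y z) as [m1 [m2 m3]].
      exists (med x y z); repeat split.
      * exact (cC x y Cx Cy _ m1).
      * exact (cl A (or_introl eq_refl) z x Az Ax _ m3).
      * exact (cl B (or_intror HB) y z By Bz _ m2).
    + exists x; split; auto; intros B [<-|HB]; [exact Ax|exact (Hx B HB)].
Qed.

Lemma inv_small eps : 0 < eps -> exists N, forall n, (N <= n)%nat -> / INR (S n) < eps.
Proof.
  intros He; destruct (archimed_cor1 eps He) as [N [H1 H2]]; exists N; intros n Hn.
  apply Rle_lt_trans with (/ INR N); auto.
  apply Rinv_le_contravar; [apply lt_0_INR; lia|apply le_INR; lia].
Qed.

Lemma inv_pos n : 0 < / INR (S n).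
Proof. apply Rinv_0_lt_compat, lt_0_INR; lia. Qed.

Lemma glb_exists (E : R -> Prop) : (exists e, E e) -> (forall e, E e -> 0 <= e) ->
  exists m, (forall e, E e -> m <= e) /\ forall eps, 0 < eps -> exists e, E e /\ e < m + eps.
Proof.
  intros [e0 He0] Hp.
  destruct (completeness (fun x => E (- x))) as [m [Hu Hl]].
  - exists 0; intros x Hx; specialize (Hp _ Hx); lra.
  - exists (- e0); now rewrite Ropp_involutive.
  - exists (- m); split.
    + intros e He; assert (- e <= m) by (apply Hu; now rewrite Ropp_involutive); lra.
    + intros eps Heps; apply NNPP; intros N.
      assert (m <= m - eps); [|lra].
      apply Hl; intros x Hx; apply Rnot_lt_le; intros L; apply N.
      exists (- x); split; [auto|lra].
Qed.

Hypothesis Hcomp : complete d.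

Lemma fast_cauchy (u : nat -> X) :
  (forall p q, d (u p) (u q) < / INR (S p) + / INR (S q)) -> exists l, converges_to X d u l.
Proof.
  intros H; apply Hcomp; intros eps He.
  destruct (inv_small (eps / 2)) as [N HN]; [lra|].
  exists N; intros p q Hp Hq; pose proof (HN p Hp); pose proof (HN q Hq).
  pose proof (H p q); lra.
Qed.

(** A minimising sequence for the distance to [x] is Cauchy: the median of [x] and two terms is in
    [C], hence no closer to [x] than the infimum, so the two terms are close to it. *)
Lemma gate_exists (C : X -> Prop) x : closed C -> convex d C -> (exists c, C c) ->
  exists c, C c /\ forall p, C p -> interval d x p c.
Proof.
  intros clC cC [c0 Hc0].
  destruct (glb_exists (fun e => exists c, C c /\ e = d x c)) as [m [Hm1 Hm2]].
  { eauto. }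
  { intros e [c [_ ->]]; apply dpos. }
  assert (U : exists u : nat -> X, forall n, C (u n) /\ d x (u n) < m + / INR (S n)).
  { exists (fun n => epsilon (inhabits x) (fun c => C c /\ d x c < m + / INR (S n))).
    intros n; apply epsilon_spec.
    destruct (Hm2 _ (inv_pos n)) as [e [[c [Hc ->]] He]]; eauto. }
  destruct U as [u Hu].
  destruct (fast_cauchy u) as [l Hl].
  { intros p q; destruct (Hu p) as [Cp Dp], (Hu q) as [Cq Dq].
    destruct (med_spec x (u p) (u q)) as [m1 [m2 m3]].
    assert (Cm : C (med x (u p) (u q))) by exact (cC _ _ Cp Cq _ m2).
    pose proof (Hm1 _ (ex_intro _ _ (conj Cm eq_refl))).
    dsat; lra. }
  assert (Cl : C l).
  { apply clC; intros eps He; destruct (Hl eps He) as [N HN].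
    exists (u N); split; [apply Hu|]; rewrite dsym; apply HN; lia. }
  assert (Dl : d x l <= m).
  { apply Rle_plus_epsilon; intros eps He.
    destruct (Hl (eps / 2)) as [N HN]; [lra|].
    destruct (inv_small (eps / 2)) as [N' HN']; [lra|].
    pose proof (HN (max N N') ltac:(lia)); pose proof (HN' (max N N') ltac:(lia)).
    destruct (Hu (max N N')) as [_ HD]; pose proof (dtri x (u (max N N')) l); lra. }
  exists l; split; auto; intros p Cp.
  destruct (med_spec x l p) as [m1 [m2 m3]].
  assert (Cm : C (med x l p)) by exact (cC _ _ Cl Cp _ m2).
  pose proof (Hm1 _ (ex_intro _ _ (conj Cm eq_refl))).
  replace l with (med x l p); [now apply interval_sym|].
  dsat; apply deq0; pose proof (dpos (med x l p) l); lra.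
Qed.

(** As the members shrink, the gates of [x] move away from [x], but no further than [M]. Gates whose
    distances approach the supremum form a Cauchy sequence, and its limit is in every member. *)
Lemma directed_inter (F : (X -> Prop) -> Prop) x M :
  (exists A, F A) ->
  (forall A, F A -> closed A /\ convex d A /\ exists a, A a /\ d x a <= M) ->
  (forall A B, F A -> F B -> exists C, F C /\ forall y, C y -> A y /\ B y) ->
  exists c, forall A, F A -> A c.
Proof.
  intros [A0 FA0] HF Hdir.
  set (gate := fun A c => A c /\ forall p, A p -> interval d x p c).
  assert (Hg : forall A, F A -> exists c, gate A c /\ d x c <= M).
  { intros A FA; destruct (HF A FA) as [H1 [H2 [a [Aa Ha]]]].
    destruct (gate_exists A x H1 H2) as [c [Ac Hc]]; [eauto|].
    exists c; split; [now split|].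
    pose proof (Hc a Aa); dsat; pose proof (dpos c a); lra. }
  (* The supremum of [d x c], written as an infimum of [M - d x c]. *)
  destruct (glb_exists (fun e => exists A c, F A /\ gate A c /\ d x c <= M /\ e = M - d x c))
    as [m [Hm1 Hm2]].
  { destruct (Hg A0 FA0) as [c [? ?]]; exists (M - d x c), A0, c; auto. }
  { intros e [A [c [_ [_ [H ->]]]]]; lra. }
  assert (near : forall A B c, F A -> F B -> gate A c ->
    exists e, B e /\ d c e <= M - m - d x c).
  { intros A B c FA FB [Ac Hc]; destruct (Hdir A B FA FB) as [C [FC HC]].
    destruct (Hg C FC) as [e [[Ce He] De]].
    exists e; split; [now apply HC|].
    assert (m <= M - d x e) by (apply Hm1; exists C, e; repeat split; auto).
    assert (interval d x e c) by (apply Hc, HC, Ce).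
    dsat; lra. }
  assert (U : exists u : nat -> X, forall n, exists A, F A /\ gate A (u n) /\
    M - d x (u n) < m + / INR (S n)).
  { exists (fun n => epsilon (inhabits x) (fun c => exists A, F A /\ gate A c /\
                      M - d x c < m + / INR (S n))).
    intros n; apply epsilon_spec.
    destruct (Hm2 _ (inv_pos n)) as [e [[A [c [FA [Gc [Hc ->]]]]] He]]; exists c, A; auto. }
  destruct U as [u Hu].
  destruct (fast_cauchy u) as [l Hl].
  { intros p q; destruct (Hu p) as [A [FA [GA DA]]], (Hu q) as [B [FB [GB DB]]].
    destruct (Hdir A B FA FB) as [C [FC HC]].
    destruct (Hg C FC) as [e [[Ce He] De]].
    assert (m <= M - d x e) by (apply Hm1; exists C, e; repeat split; auto).
    assert (interval d x e (u p)) by (apply GA, HC, Ce).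
    assert (interval d x e (u q)) by (apply GB, HC, Ce).
    dsat; pose proof (dtri (u p) e (u q)); lra. }
  exists l; intros B FB; apply HF; auto; intros eps He.
  destruct (Hl (eps / 2)) as [N HN]; [lra|].
  destruct (inv_small (eps / 2)) as [N' HN']; [lra|].
  set (n := max N N').
  pose proof (HN n ltac:(unfold n; lia)); pose proof (HN' n ltac:(unfold n; lia)).
  destruct (Hu n) as [A [FA [GA DA]]].
  destruct (near A B (u n) FA FB GA) as [e [Be De]].
  exists e; split; auto; dsat; pose proof (dtri l (u n) e); lra.
Qed.

(** With [b0] the gate of [a0] in [B] and [a1] the gate of [b0] in [A], taking the median with [a1]
    and [b0] collapses [A] to [a1] and [B] to [b0], and is 1-Lipschitz. *)
Lemma disjoint_gap (A B : X -> Prop) : closed A -> convex d A -> (exists a, A a) ->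
  closed B -> convex d B -> (exists b, B b) -> (forall x, A x -> ~ B x) ->
  exists eps, 0 < eps /\ forall a b, A a -> B b -> eps <= d a b.
Proof.
  intros clA cA [a0 Ha0] clB cB neB D.
  destruct (gate_exists B a0 clB cB neB) as [b0 [Bb Gb]].
  destruct (gate_exists A b0 clA cA (ex_intro _ a0 Ha0)) as [a1 [Aa Ga]].
  exists (d a1 b0); split.
  - destruct (dpos a1 b0) as [H|H]; auto.
    symmetry in H; apply deq0 in H; subst; now destruct (D b0).
  - intros a b Ha Hb.
    assert (Ea : med a1 b0 a = a1).
    { specialize (Ga a Ha); symmetry; apply med_unique; auto using interval_l, interval_sym. }
    assert (Eb : med a1 b0 b = b0).
    (* By choice [b0] is the gate of [a0]; that it is also the gate of [a1] is checked on
       halfspaces. *)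
    { apply halfspace_ext; intros h Hh Hm; apply NNPP; intros N.
      apply halfspace_med in Hm; auto.
      destruct Hm as [[? ?]|[[? ?]|[h1 h2]]]; try tauto.
      destruct (halfspace_interval' _ a0 b b0 (halfspace_compl h Hh) (Gb b Hb) N); [|tauto].
      exact (halfspace_interval _ b0 a0 a1 (halfspace_compl h Hh) (Ga a0 Ha0) N H h2). }
    pose proof (med_lipschitz a1 b0 a b); congruence.
Qed.

(** * Convex hulls in finite rank *)

Variable r : nat.
Hypothesis Hrank : rank_le d r.

(** For a nonempty list this is the convex hull, since halfspaces separate points from convex
    sets. *)
Definition hull (l : list X) (z : X) : Prop :=
  forall h, halfspace d h -> (forall a, In a l -> h a) -> h z.

Lemma hull_in l a : In a l -> hull l a.
Proof. intros H h _ Hl; auto. Qed.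

Lemma hull_convex l : convex d (hull l).
Proof.
  intros x y Hx Hy z Hz h Hh Hl.
  exact (halfspace_interval h x y z Hh Hz (Hx h Hh Hl) (Hy h Hh Hl)).
Qed.

Lemma hull_incl l l' z : incl l l' -> hull l z -> hull l' z.
Proof. intros H Hz h Hh Hl; apply Hz; auto. Qed.

(* For a hull point z of a minimal list a_1, ..., a_n, separating z from the list without a_i
   gives a halfspace containing z and a_i but no other a_j; for n >= 3 these n halfspaces are
   pairwise transverse. *)
Lemma caratheodory n : forall l z, (length l <= n)%nat -> l <> nil -> hull l z ->
  exists l', l' <> nil /\ incl l' l /\ (length l' <= r + 2)%nat /\ hull l' z.
Proof.
  induction n as [|n IH]; intros l z Hn Hl Hz.
  { destruct l; simpl in *; [easy|lia]. }
  destruct (Compare_dec.le_gt_dec (length l) (r + 2)) as [L|L].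
  { exists l; auto using incl_refl. }
  destruct (classic (exists a l1 l2, l = l1 ++ a :: l2 /\ hull (l1 ++ l2) z))
    as [[a [l1 [l2 [E Hz']]]]|N].
  { assert (E' : length l = S (length (l1 ++ l2)))
      by (subst; rewrite !length_app; simpl; lia).
    destruct (IH (l1 ++ l2) z) as [l' [H1 [H2 H3]]]; auto; try lia.
    { intros E''; rewrite E'' in E'; simpl in *; lia. }
    exists l'; repeat split; auto; try tauto.
    intros b Hb; apply H2 in Hb; subst; rewrite in_app_iff in *; simpl; tauto. }
  exfalso.
  set (P := fun i k => halfspace d k /\ k z /\ k (nth i l z) /\
    forall j, (j < length l)%nat -> j <> i -> ~ k (nth j l z)).
  assert (HP : exists k, forall i, (i < length l)%nat -> P i (k i)).
  { exists (fun i => epsilon (inhabits (fun _ => True)) (P i)).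
    intros i Hi; apply epsilon_spec.
    destruct (nth_split l z Hi) as [l1 [l2 [E E1]]].
    assert (N' : ~ hull (l1 ++ l2) z) by (intros H; apply N; eauto).
    apply not_all_ex_not in N'; destruct N' as [h N'].
    apply imply_to_and in N'; destruct N' as [Hh N'].
    apply imply_to_and in N'; destruct N' as [Hin Nz].
    exists (fun x => ~ h x); split; [|split; [|split]]; auto using halfspace_compl.
    - intros Hi'; apply Nz, Hz; auto; intros a Ha; rewrite E in Ha.
      apply in_app_iff in Ha; destruct Ha as [Ha|[<-|Ha]]; auto; apply Hin, in_app_iff; auto.
    - intros j Hj Hji Hn'; apply Hn', Hin; rewrite E.
      destruct (Compare_dec.lt_dec j i).
      + rewrite app_nth1 by lia; apply in_app_iff; left; apply nth_In; lia.
      + rewrite app_nth2 by lia; replace (j - length l1)%nat with (S (j - i - 1)) by lia; simpl.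
        apply in_app_iff; right; apply nth_In.
        rewrite E, length_app in Hj; simpl in Hj; lia. }
  destruct HP as [k Hk].
  assert (T : forall m, exists j, (j < length l)%nat /\ ~ (j = fst m) /\ ~ (j = snd m)).
  { intros [a b]; simpl.
    destruct (Nat.eq_dec 0 a), (Nat.eq_dec 0 b), (Nat.eq_dec 1 a), (Nat.eq_dec 1 b);
      solve [exists 0%nat; lia | exists 1%nat; lia | exists 2%nat; lia]. }
  assert (length l <= r)%nat; [|lia].
  apply (Hrank _ k).
  - intros i Hi; apply (Hk i Hi).
  - intros i j Hi Hj Hij.
    destruct (Hk i Hi) as [_ [zi [ii ni]]], (Hk j Hj) as [_ [zj [jj nj]]].
    destruct (T (i, j)) as [t [Ht [t1 t2]]]; simpl in *; unfold compl.
    split; [exists z|split; [exists (nth i l z)|split; [exists (nth j l z)|exists (nth t l z)]]];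
      split; unfold compl; auto.
Qed.

(** The join of [hull l] and [a] is convex; were [z] outside, a halfspace containing the join would
    miss [z]. *)
Lemma hull_cons a l z : l <> nil -> hull (a :: l) z -> exists p, hull l p /\ interval d p a z.
Proof.
  intros Hl Hz; apply NNPP; intros N.
  destruct l as [|b l]; [easy|].
  destruct (kakutani (join (hull (b :: l)) a) (eq z)) as [h [Hh [h1 h2]]];
    eauto using singleton_convex, join_convex, hull_convex.
  - exists a, b; split; [apply hull_in; simpl; auto|apply interval_r].
  - intros x [p [Hp1 Hp2]] <-; eauto.
  - apply (h2 z eq_refl), Hz; auto; intros c [<-|Hc]; apply h1.
    + exists b; split; [apply hull_in; simpl; auto|apply interval_r].
    + exists c; split; [now apply hull_in|apply interval_l].
Qed.

(** Points of the list are added one at a time, each costing [eps] by perturbation of an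
    interval. *)
Lemma hull_near C eps l : convex d C -> forall z, l <> nil ->
  (forall a, In a l -> exists c, C c /\ d a c < eps) -> hull l z ->
  exists c, C c /\ d z c < INR (length l) * eps.
Proof.
  intros cC; induction l as [|a l IH]; intros z Hl Hn Hz; [easy|].
  destruct l as [|b l].
  - destruct (Hn a) as [c [Cc Hc]]; simpl; auto; exists c; split; auto.
    replace z with a; [lra|].
    apply halfspace_ext; intros h Hh Ha; apply Hz; auto; now intros ? [<-|[]].
  - destruct (hull_cons a (b :: l) z) as [p [Hp Hi]]; auto; [easy|].
    destruct (IH p) as [c [Cc Hc]]; auto; [easy|intros; apply Hn; simpl in *; tauto|].
    destruct (Hn a (or_introl eq_refl)) as [e [Ce He]].
    exists (med c e z); split.
    + destruct (med_spec c e z) as [Hm _]; exact (cC _ _ Cc Ce _ Hm).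
    + pose proof (interval_perturb p a z c e Hi).
      assert (E : INR (length (a :: b :: l)) = INR (length (b :: l)) + 1) by exact (S_INR _).
      rewrite E; lra.
Qed.

(** The convex hull as a union over finite lists, so that each of its points needs at most [r + 2]
    points of [A]. *)
Definition conv (A : X -> Prop) (z : X) : Prop :=
  exists l, l <> nil /\ (forall a, In a l -> A a) /\ hull l z.

Lemma conv_in (A : X -> Prop) a : A a -> conv A a.
Proof.
  intros Aa; exists (a :: nil); split; [easy|split; [now intros ? [<-|[]]|]].
  apply hull_in; simpl; auto.
Qed.

Lemma conv_convex A : convex d (conv A).
Proof.
  intros x y [l [Hl [Hc Hx]]] [l' [Hl' [Hc' Hy]]] z Hz.
  exists (l ++ l'); split; [|split].
  - destruct l; easy.
  - intros a Ha; apply in_app_iff in Ha; destruct Ha; auto.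
  - apply (hull_convex (l ++ l') x y); auto;
      [apply hull_incl with l|apply hull_incl with l']; auto using incl_appl, incl_appr, incl_refl.
Qed.

Lemma conv_near (A C : X -> Prop) eps z : 0 < eps -> convex d C ->
  (forall a, A a -> exists c, C c /\ d a c < eps) -> conv A z ->
  exists c, C c /\ d z c < INR (r + 2) * eps.
Proof.
  intros He cC HA [l [Hl [Hc Hz]]].
  destruct (caratheodory (length l) l z) as [l' [H1 [H2 [H3 H4]]]]; auto.
  destruct (hull_near C eps l' cC z) as [c [Cc Hc']]; auto.
  exists c; split; auto; apply Rlt_le_trans with (1 := Hc').
  apply Rmult_le_compat_r; [lra|now apply le_INR].
Qed.

Lemma thick_separation (A B : X -> Prop) delta :
  convex d A -> convex d B -> (exists a, A a) -> (exists b, B b) -> 0 < delta ->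
  (forall a b, A a -> B b -> delta <= d a b) ->
  exists h eps, halfspace d h /\ 0 < eps /\ (forall a v, A a -> d a v < eps -> h v) /\
    (forall b v, B b -> d b v < eps -> ~ h v).
Proof.
  intros cA cB [a0 Ha0] [b0 Hb0] Hd Hgap.
  set (n := INR (r + 2)).
  assert (Hn : 0 < n) by (apply lt_0_INR; lia).
  (* The hulls of the [eps]-neighbourhoods stay within [n * eps], half of [delta], of [A] and of
     [B], so they are disjoint. *)
  set (eps := delta / (2 * n)).
  assert (He : 0 < eps) by (apply Rdiv_lt_0_compat; lra).
  set (near := fun (C : X -> Prop) v => exists c, C c /\ d v c < eps).
  assert (N0 : forall (C : X -> Prop) c v, C c -> d c v < eps -> conv (near C) v).
  { intros C c v Cc Hv; apply conv_in; exists c; rewrite dsym; auto. }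
  destruct (kakutani (conv (near A)) (conv (near B))) as [h [Hh [h1 h2]]]; auto using conv_convex.
  - exists a0; apply (N0 A a0); auto; now rewrite dxx.
  - exists b0; apply (N0 B b0); auto; now rewrite dxx.
  - intros z HA HB; apply conv_near with (C := A) (eps := eps) in HA; auto.
    apply conv_near with (C := B) (eps := eps) in HB; auto; fold n in HA, HB.
    destruct HA as [a [Aa Ha]], HB as [b [Bb Hb]].
    assert (n * eps = delta / 2) by (unfold eps; field; lra).
    pose proof (Hgap a b Aa Bb); dsat; pose proof (dtri a z b); lra.
  - exists h, eps; repeat split; eauto; apply Hh.
Qed.

(** * Chains of halfspaces and elliptic isometries *)

Lemma transverse_sym (h k : X -> Prop) : transverse h k -> transverse k h.
Proof. intros [[a ?] [[b ?] [[c ?] [e ?]]]]; repeat split; eexists; apply and_comm; eauto. Qed.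

Lemma decreasing_le (h : nat -> X -> Prop) n :
  (forall i, (i < n)%nat -> forall x, h (S i) x -> h i x) ->
  forall i j x, (i <= j)%nat -> (j <= n)%nat -> h j x -> h i x.
Proof.
  intros H i j x Hij; induction Hij; auto; intros Hn Hx; apply IHHij; [lia|].
  apply H; auto.
Qed.

Definition strict_chain (h : nat -> X -> Prop) n : Prop :=
  (forall i, (i <= n)%nat -> halfspace d (h i)) /\
  (forall i, (i < n)%nat -> forall x, h (S i) x -> h i x) /\
  (forall i, (i < n)%nat -> exists x, h i x /\ ~ h (S i) x).

(* Induction step: pick w between c and w0 in h_n but not in h_(n+1).  The halfspaces obtained
   between c and w miss some z of h_(n+1) close to c; any thick halfspace separating [w0, z]
   from [c, w] is transverse to all of them. *)
Lemma transverse_of_chain n : forall h c w0, strict_chain h n ->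
  ~ h 0%nat c -> h n w0 -> closure (h n) c ->
  exists j eps, 0 < eps /\
    (forall i, (i <= n)%nat -> halfspace d (j i) /\ j i w0 /\ forall v, d c v < eps -> ~ j i v) /\
    (forall i k, (i <= n)%nat -> (k <= n)%nat -> i <> k -> transverse (j i) (j k)).
Proof.
  induction n as [|n IH]; intros h c w0 [Hh [Hdec Hstr]] Hc Hw Hcl.
  - assert (N : c <> w0) by congruence.
    destruct (thick_separation (eq w0) (eq c) (d w0 c)) as [j [eps [Hj [He [H1 H2]]]]];
      eauto using singleton_convex.
    + destruct (dpos w0 c) as [H|H]; auto; symmetry in H; apply deq0 in H; congruence.
    + intros a b <- <-; lra.
    + exists (fun _ => j), eps; split; [|split]; auto.
      * intros i _; split; [|split]; auto; [|intros v Hv; now apply (H2 c)].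
        apply (H1 w0); auto; now rewrite dxx.
      * intros; lia.
  - destruct (Hstr n) as [x [Hx Nx]]; [lia|].
    assert (Hcn : forall i, (i <= S n)%nat -> ~ h i c).
    { intros i Hi Hic; apply Hc, (decreasing_le h (S n)) with i; auto; lia. }
    destruct (med_spec c x w0) as [w1 [w2 w3]]; set (w := med c x w0) in *.
    assert (hw : h n w).
    { apply (halfspace_interval (h n) x w0); auto. }
    assert (nw : ~ h (S n) w).
    { intros H; apply (halfspace_interval' (h (S n)) c x w) in H; auto.
      destruct H; auto; now apply (Hcn (S n)). }
    destruct (IH h c w) as [j [e1 [He1 [Hj Tj]]]]; auto.
    { split; [|split]; intros i Hi; [apply Hh|apply Hdec|apply Hstr]; lia. }
    { apply closure_mono with (2 := Hcl); apply Hdec; lia. }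
    destruct (Hcl e1 He1) as [z [Hz Dz]].
    assert (D : forall y, interval d w0 z y -> ~ interval d c w y).
    { intros y Hy1 Hy2.
      apply (halfspace_interval (h (S n))) in Hy1; auto.
      apply (halfspace_interval' (h (S n))) in Hy2; auto.
      destruct Hy2; auto; now apply (Hcn (S n)). }
    destruct (disjoint_gap (interval d w0 z) (interval d c w)) as [dl [Hd Hgap]];
      auto using interval_closed, interval_convex.
    { exists w0; apply interval_l. }
    { exists c; apply interval_l. }
    destruct (thick_separation (interval d w0 z) (interval d c w) dl)
      as [k [e2 [Hk [He2 [K1 K2]]]]]; auto using interval_convex.
    { exists w0; apply interval_l. }
    { exists c; apply interval_l. }
    assert (kw0 : k w0) by (apply (K1 w0); [apply interval_l|now rewrite dxx]).
    assert (kz : k z) by (apply (K1 z); [apply interval_r|now rewrite dxx]).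
    assert (kw : ~ k w) by (apply (K2 w); [apply interval_r|now rewrite dxx]).
    assert (kc : ~ k c) by (apply (K2 c); [apply interval_l|now rewrite dxx]).
    assert (jw0 : forall i, (i <= n)%nat -> j i w0).
    { intros i Hi; destruct (Hj i Hi) as [Hji [jw jn]].
      apply (halfspace_interval' (j i) w0 c w) in jw; auto.
      destruct jw as [|jw]; auto; exfalso; apply (jn c); auto; now rewrite dxx. }
    assert (Tk : forall i, (i <= n)%nat -> transverse (j i) k).
    { intros i Hi; destruct (Hj i Hi) as [Hji [jw jn]].
      split; [exists w0|split; [exists w|split; [exists z|exists c]]]; split; unfold compl; auto.
      apply jn; now rewrite dxx. }
    exists (fun i => if Nat.eqb i (S n) then k else j i), (Rmin e1 e2); split; [|split].
    + now apply Rmin_glb_lt.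
    + intros i Hi; destruct (Nat.eqb_spec i (S n)) as [->|Ni].
      * split; [|split]; auto; intros v Hv; apply (K2 c); [apply interval_l|].
        apply Rlt_le_trans with (1 := Hv), Rmin_r.
      * destruct (Hj i) as [Hji [jw jn]]; [lia|].
        split; [|split]; auto; [apply jw0; lia|]; intros v Hv; apply jn.
        apply Rlt_le_trans with (1 := Hv), Rmin_l.
    + intros i l Hi Hl Hil.
      destruct (Nat.eqb_spec i (S n)) as [->|Ni], (Nat.eqb_spec l (S n)) as [->|Nl].
      * lia.
      * apply transverse_sym, Tk; lia.
      * apply Tk; lia.
      * apply Tj; lia.
Qed.

(** The [r + 1] members [h 0], ..., [h r] would yield [r + 1] pairwise transverse halfspaces. *)
Lemma no_long_chain h c : strict_chain h r -> ~ h 0%nat c -> closure (h r) c -> False.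
Proof.
  intros Hh Hc Hcl; destruct (Hcl 1 Rlt_0_1) as [w [Hw _]].
  destruct (transverse_of_chain r h c w) as [j [eps [He [Hj Tj]]]]; auto.
  assert (S r <= r)%nat; [|lia].
  apply (Hrank (S r) j).
  - intros i Hi; apply Hj; lia.
  - intros i k Hi Hk; apply Tj; lia.
Qed.

(** A point [c] in both closures contradicts [no_long_chain]: for the complements of [h r], ...,
    [h 0] if [h r] contains [c], and for [h r], ..., [h (2 * r)] otherwise. *)
Lemma chain_gap h : strict_chain h (2 * r) ->
  exists eps, 0 < eps /\ forall u v, ~ h 0%nat u -> h (2 * r)%nat v -> eps <= d u v.
Proof.
  intros [Hh [Hdec Hstr]].
  destruct (Hh 0%nat) as [_ [[u0 Hu0] [_ c0]]]; [lia|].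
  destruct (Hh (2 * r)%nat) as [[v0 Hv0] [_ [c1 _]]]; [lia|].
  destruct (disjoint_gap (closure (compl X (h 0%nat))) (closure (h (2 * r)%nat)))
    as [eps [He Hgap]]; auto using closure_closed, closure_convex.
  - exists u0; now apply closure_sub.
  - exists v0; now apply closure_sub.
  - intros c Hc0 Hc1; destruct (classic (h r c)) as [Hr|Hr].
    + apply (no_long_chain (fun i x => ~ h (r - i)%nat x) c).
      * split; [|split]; intros i Hi.
        -- apply halfspace_compl, Hh; lia.
        -- intros x Hx Hx'; apply Hx, Hdec; [lia|].
           now replace (S (r - S i)) with (r - i)%nat by lia.
        -- destruct (Hstr (r - S i)%nat) as [x [Hx Nx]]; [lia|].
           replace (S (r - S i)) with (r - i)%nat in Nx by lia; exists x; auto.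
      * rewrite Nat.sub_0_r; auto.
      * now rewrite Nat.sub_diag.
    + apply (no_long_chain (fun i => h (r + i)%nat) c).
      * split; [|split]; intros i Hi.
        -- apply Hh; lia.
        -- rewrite Nat.add_succ_r; apply Hdec; lia.
        -- rewrite Nat.add_succ_r; apply Hstr; lia.
      * now rewrite Nat.add_0_r.
      * now replace (r + r)%nat with (2 * r)%nat by lia.
  - exists eps; split; auto; intros u v Hu Hv; apply Hgap; now apply closure_sub.
Qed.

Lemma halfspace_comp f f' h : isometry d f -> (forall x, f (f' x) = x) ->
  halfspace d h -> halfspace d (fun x => h (f x)).
Proof.
  intros Hf Hff [[a Ha] [[b Hb] [c1 c2]]]; repeat split.
  - exists (f' a); now rewrite Hff.
  - exists (f' b); now rewrite Hff.
  - intros x y Hx Hy z Hz; apply (c1 (f x) (f y)); auto; unfold interval; now rewrite !Hf.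
  - intros x y Hx Hy z Hz; apply (c2 (f x) (f y)); auto; unfold interval; now rewrite !Hf.
Qed.

(** Composing [k] with [g'] gives its translate by [g]. The gate [a] of [x] in the closure of this
    translate is at distance at least [eps] from [x] and still outside the second translate, so
    induction applies after two applications of [g']. *)
Lemma skewer_unbounded g g' k eps : isometry d g' ->
  (forall x, g' (g x) = x) -> (forall x, g (g' x) = x) -> halfspace d k ->
  (forall x, k (g' x) -> k x) -> (exists x, k x /\ ~ k (g' x)) ->
  (forall u v, ~ k u -> k (g' v) -> eps <= d u v) ->
  forall n x y, ~ k x -> k (Nat.iter (2 * n) g' y) -> INR n * eps <= d x y.
Proof.
  intros Hg G1 G2 Hk Hdec [z0 [Hz Nz]] Hgap.
  assert (Hit : forall m v, k (Nat.iter m g' v) -> k v)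
    by (induction m; simpl; intros v Hv; [exact Hv|exact (IHm v (Hdec _ Hv))]).
  induction n as [|n IH]; intros x y Hx Hy.
  { simpl; pose proof (dpos x y); lra. }
  replace (2 * S n)%nat with (S (S (2 * n))) in Hy by lia.
  rewrite !Nat.iter_succ_r in Hy.
  set (D := fun v => k (g' v)).
  assert (HD : halfspace d D) by (apply (halfspace_comp g' g k); auto).
  destruct (gate_exists (closure D) x) as [a [Ca Ga]].
  { apply closure_closed. }
  { apply closure_convex, HD. }
  { destruct HD as [[v Hv] _]; exists v; now apply closure_sub. }
  assert (Dxa : eps <= d x a).
  { apply Rle_plus_epsilon; intros eta Heta; destruct (Ca eta Heta) as [v [Hv Dv]].
    pose proof (Hgap x v Hx Hv); pose proof (dtri x a v); lra. }
  (* The gate lies between [x] and [g z0], both outside the second translate. *)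
  assert (Na : ~ k (g' (g' a))).
  { assert (HD2 : halfspace d (fun v => k (g' (g' v)))) by (apply (halfspace_comp g' g D); auto).
    intros Ka; apply (halfspace_interval' _ x (g z0) a HD2) in Ka.
    - rewrite G1 in Ka; destruct Ka; auto.
    - apply Ga, closure_sub; unfold D; now rewrite G1. }
  assert (Dy : D y) by (apply (Hdec (g' y)), (Hit (2 * n)%nat); auto).
  pose proof (Ga y (closure_sub _ _ Dy)) as Hi.
  pose proof (IH (g' (g' a)) (g' (g' y)) Na Hy) as HI.
  rewrite !Hg in HI; rewrite S_INR; unfold interval in Hi; lra.
Qed.

(** Otherwise the translates of [k] by powers of [g] form a strict chain; a power of [g] then has a
    gap, and the orbit of [x0] is unbounded. *)
Lemma elliptic_no_skewer g g' k : isometry d g' ->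
  (forall x, g' (g x) = x) -> (forall x, g (g' x) = x) -> elliptic d g -> halfspace d k ->
  (forall x, k (g' x) -> k x) -> forall x, k x -> k (g' x).
Proof.
  intros Hg G1 G2 He Hk Hdec x0 Hx0; apply NNPP; intros Nx0.
  assert (Hit : forall m v, k (Nat.iter m g' v) -> k v)
    by (induction m; simpl; intros v Hv; [exact Hv|exact (IHm v (Hdec _ Hv))]).
  assert (Hiso : forall m, isometry d (Nat.iter m g'))
    by (induction m; intros u v; simpl; auto; now rewrite Hg).
  destruct (chain_gap (fun i x => k (Nat.iter i g' x))) as [eps [Heps Hgap]].
  { split; [|split]; intros i Hi.
    - apply (halfspace_comp (Nat.iter i g') (Nat.iter i g)); auto.
      intros; now apply iter_cancel.
    - intros x; rewrite Nat.iter_succ_r; intros Hx.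
      rewrite <- Nat.iter_succ_r in Hx; simpl in Hx; auto.
    - exists (Nat.iter i g x0); simpl; now rewrite iter_cancel. }
  (* The gap needs [2 * r] steps; one more keeps the power nontrivial when [r] is 0. *)
  set (N := S (2 * r)).
  destruct (He x0) as [B HB].
  pose proof Hk as [_ [[u Hu] _]].
  destruct (INR_unbounded ((d u x0 + B) / eps)) as [n Hn].
  apply Rmult_lt_compat_r with (r := eps) in Hn; auto.
  replace ((d u x0 + B) / eps * eps) with (d u x0 + B) in Hn by (field; lra).
  set (y := Nat.iter (2 * n) (Nat.iter N g) x0).
  assert (INR n * eps <= d u y).
  { apply (skewer_unbounded (Nat.iter N g) (Nat.iter N g') k eps); auto.
    - intros; now apply iter_cancel.
    - intros; now apply iter_cancel.
    - intros x Hx; exact (Hit N x Hx).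
    - exists x0; split; auto; unfold N; rewrite Nat.iter_succ_r; eauto.
    - unfold y; rewrite iter_cancel; auto; intros; now apply iter_cancel. }
  unfold y in H; rewrite iter_mul in H; pose proof (HB (2 * n * N)%nat).
  pose proof (dtri u x0 (Nat.iter (2 * n * N) g x0)); lra.
Qed.

(** * Bounded orbits *)

(* The edges [z, z'] are subdivided until every fa t, fb t projects to an endpoint; on such an
   edge each pair either moves nothing or is separated by every halfspace cutting the edge. *)
Lemma sum_dist_le_multiplicity (T : Type) (l : list T) (fa fb : T -> X) x y K :
  (forall t, In t l -> forall h, halfspace d h -> h (fb t) -> ~ h (fa t) -> h y /\ ~ h x) ->
  (forall h, halfspace d h -> sum (fun t => ind (~ h (fa t) /\ h (fb t))) l <= K) ->
  sum (fun t => d (fa t) (fb t)) l <= K * d x y.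
Proof.
  intros H1 H2.
  set (psi := fun z z' t => d (med (fa t) (fb t) z) (med (fa t) (fb t) z')).
  set (pure := fun z z' c => med c z z' = z \/ med c z z' = z').
  set (oriented := fun z z' => forall h, halfspace d h -> h z' -> ~ h z -> h y /\ ~ h x).
  assert (claim : forall F z z', oriented z z' ->
    (forall t, In t l -> (In (fa t) F \/ pure z z' (fa t)) /\ (In (fb t) F \/ pure z z' (fb t))) ->
    sum (psi z z') l <= K * d z z').
  (* [F] lists the points that need not yet project to an endpoint of the edge. *)
  { induction F as [|c F IH]; intros z z' Ho Hp.
    - destruct (classic (forall h, halfspace d h -> h z' -> h z)) as [E|N].
      + apply halfspace_ext in E; subst z'; rewrite dxx.
        replace (K * 0) with (sum (fun _ : T => 0 * 0) l) by (rewrite sum_scal; ring).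
        apply sum_le; intros t _; unfold psi; rewrite dxx; lra.
      + apply not_all_ex_not in N; destruct N as [h N].
        apply imply_to_and in N; destruct N as [Hh N].
        apply imply_to_and in N; destruct N as [hz' hz].
        apply Rle_trans with (sum (fun t => ind (~ h (fa t) /\ h (fb t))) l * d z z').
        2: { apply Rmult_le_compat_r; auto using dpos. }
        rewrite <- sum_scal; apply sum_le; intros t Ht.
        destruct (Hp t Ht) as [[[]|Pa] [[]|Pb]].
        destruct (classic (med (fa t) z z' = med (fb t) z z')) as [E|Nab].
        * replace (psi z z' t) with 0.
          { unfold ind; destruct decb; pose proof (dpos z z'); lra. }
          unfold psi; replace (med (fa t) (fb t) z') with (med (fa t) (fb t) z);
            [now rewrite dxx|].
          apply halfspace_ext; intros k Hk.
          assert (E' : k (med (fa t) z z') <-> k (med (fb t) z z')) by now rewrite E.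
          rewrite !halfspace_med in * by auto; clear - E'.
          intros [H|[[H H']|[H H']]]; [tauto| |];
            [destruct (proj2 E') as [[]|[[]|[]]]|destruct (proj1 E') as [[]|[[]|[]]]]; auto.
        * assert (Ma := halfspace_med h (fa t) z z' Hh).
          assert (Mb := halfspace_med h (fb t) z z' Hh).
          destruct Pa as [Pa|Pa], Pb as [Pb|Pb]; try congruence; rewrite Pa in Ma; rewrite Pb in Mb.
          -- replace (ind (~ h (fa t) /\ h (fb t))) with 1.
             { unfold psi; pose proof (med_lipschitz (fa t) (fb t) z z'); lra. }
             unfold ind; rewrite (proj2 (decb_true _)); tauto.
          (* Here the complement of [h] would be crossed from [fa t] to [fb t], against the
             orientation of the edge. *)
          -- destruct (H1 t Ht _ (halfspace_compl h Hh)); try tauto.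
             destruct (Ho h Hh hz' hz); tauto.
    - destruct (med_spec z z' c) as [Hw _]; set (w := med z z' c) in *.
      assert (Iz : oriented z w /\ oriented w z').
      { split; intros k Hk K1 K2; apply (Ho k Hk).
        - apply (halfspace_interval' k z z' w Hk Hw) in K1; tauto.
        - auto.
        - auto.
        - intros K3; apply K2, (halfspace_interval k z z' w Hk Hw); auto. }
      (* Cutting at the projection [w] of [c] makes [c] pure on both parts and keeps pure the points
         that were. *)
      assert (Pw : forall e, c = e \/ pure z z' e -> pure z w e /\ pure w z' e).
      { intros e [<-|He].
        - assert (E1 : med c z w = w) by
            (apply halfspace_ext; intros k Hk; unfold w; rewrite !halfspace_med by auto; tauto).
          assert (E2 : med c w z' = w) by
            (apply halfspace_ext; intros k Hk; unfold w; rewrite !halfspace_med by auto; tauto).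
          split; [right|left]; auto.
        - assert (J : forall k, halfspace d k -> (k z -> k z' -> k w) /\ (k w -> k z \/ k z')).
          { intros k Hk; split; [apply (halfspace_interval k z z' w Hk Hw)|
                                 apply (halfspace_interval' k z z' w Hk Hw)]. }
          destruct He as [He|He].
          + assert (E1 : med e z w = z).
            { apply halfspace_ext; intros k Hk; destruct (J k Hk).
              assert (E := halfspace_med k e z z' Hk); rewrite He in E.
              rewrite halfspace_med by auto; tauto. }
            assert (E2 : med e w z' = w).
            { apply halfspace_ext; intros k Hk; destruct (J k Hk).
              assert (E := halfspace_med k e z z' Hk); rewrite He in E.
              rewrite halfspace_med by auto; tauto. }
            split; left; auto.
          + assert (E1 : med e z w = w).
            { apply halfspace_ext; intros k Hk; destruct (J k Hk).
              assert (E := halfspace_med k e z z' Hk); rewrite He in E.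
              rewrite halfspace_med by auto; tauto. }
            assert (E2 : med e w z' = z').
            { apply halfspace_ext; intros k Hk; destruct (J k Hk).
              assert (E := halfspace_med k e z z' Hk); rewrite He in E.
              rewrite halfspace_med by auto; tauto. }
            split; right; auto. }
      assert (S1 : sum (psi z w) l <= K * d z w).
      { apply IH; [apply Iz|]; intros t Ht; destruct (Hp t Ht) as [Pa Pb].
        pose proof (Pw (fa t)); pose proof (Pw (fb t)); simpl in *; tauto. }
      assert (S2 : sum (psi w z') l <= K * d w z').
      { apply IH; [apply Iz|]; intros t Ht; destruct (Hp t Ht) as [Pa Pb].
        pose proof (Pw (fa t)); pose proof (Pw (fb t)); simpl in *; tauto. }
      apply Rle_trans with (sum (fun t => psi z w t + psi w z' t) l).
      + apply sum_le; intros t _; apply dtri.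
      + rewrite sum_plus; unfold interval in Hw; rewrite <- Hw; lra. }
  apply Rle_trans with (sum (psi x y) l).
  - apply sum_le; intros t Ht; unfold psi.
    assert (E1 : med (fa t) (fb t) x = fa t).
    { apply halfspace_ext; intros k Hk.
      pose proof (H1 t Ht k Hk); pose proof (H1 t Ht _ (halfspace_compl k Hk)).
      rewrite halfspace_med by auto; tauto. }
    assert (E2 : med (fa t) (fb t) y = fb t).
    { apply halfspace_ext; intros k Hk.
      pose proof (H1 t Ht k Hk); pose proof (H1 t Ht _ (halfspace_compl k Hk)).
      rewrite halfspace_med by auto; tauto. }
    rewrite E1, E2; lra.
  - apply (claim (map fa l ++ map fb l)).
    + intros h Hh; auto.
    + intros t Ht; split; left; apply in_app_iff; [left|right]; now apply in_map.
Qed.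

(** * The group generated by [S] and its orbit paths *)

Variable S : list ((X -> X) * (X -> X)).
Hypothesis Hgen : forall p, In p S -> good_generator d p.

Lemma in_group_comp f g : in_group S f -> in_group S g -> in_group S (fun x => f (g x)).
Proof.
  intros Hf Hg; induction Hf as [|p f Hp Hf IH|p f Hp Hf IH]; auto.
  - exact (in_group_l X S p _ Hp IH).
  - exact (in_group_r X S p _ Hp IH).
Qed.

Lemma in_group_fst p : In p S -> in_group S (fst p).
Proof. intros Hp; exact (in_group_l X S p _ Hp (in_group_id X S)). Qed.

Lemma in_group_snd p : In p S -> in_group S (snd p).
Proof. intros Hp; exact (in_group_r X S p _ Hp (in_group_id X S)). Qed.

Lemma in_group_inverse g : in_group S g -> exists g', in_group S g' /\ inverse g g'.
Proof.
  induction 1 as [|p g Hp Hg [g' [Hg' [I1 I2]]]|p g Hp Hg [g' [Hg' [I1 I2]]]].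
  - exists (fun x => x); repeat split; constructor.
  - exists (fun x => g' (snd p x)); destruct (Hgen p Hp) as [_ [_ [J1 J2]]].
    split; [apply in_group_comp; auto using in_group_snd|].
    split; intros x; [now rewrite J2|now rewrite I2].
  - exists (fun x => g' (fst p x)); destruct (Hgen p Hp) as [_ [_ [J1 J2]]].
    split; [apply in_group_comp; auto using in_group_fst|].
    split; intros x; [now rewrite J1|now rewrite I2].
Qed.

Lemma in_group_isometry g : in_group S g -> isometry d g.
Proof.
  induction 1 as [|p g Hp Hg IH|p g Hp Hg IH]; intros x y; auto;
    destruct (Hgen p Hp) as [I1 [I2 _]]; [rewrite I1|rewrite I2]; apply IH.
Qed.

(** No element maps a halfspace strictly inside itself. From here on, ellipticity enters only in
    this form. *)
Definition no_skewer : Prop := forall g g' k, in_group S g -> in_group S g' -> inverse g g' ->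
  halfspace d k -> (forall x, k (g' x) -> k x) -> forall x, k x -> k (g' x).

(* pos and pos' are inverse to each other; pos x0 and pos (gen x0) are consecutive points of an
   orbit path, and start, stop the corresponding points of the monotone path below. *)
Record step := Step { pos : X -> X; pos' : X -> X; gen : X -> X; start : X; stop : X }.

Definition generators : list (X -> X) := map fst S ++ map snd S.

Section Path.
Variables (x0 y0 : X).

Definition good_step (t : step) : Prop :=
  in_group S (pos t) /\ in_group S (pos' t) /\ inverse (pos t) (pos' t) /\
  In (gen t) generators /\
  forall h, halfspace d h -> ~ h (start t) -> h (stop t) ->
    h y0 /\ ~ h (pos t x0) /\ h (pos t (gen t x0)).

Definition before (x y : X) : Prop := forall h, halfspace d h -> h y0 -> h x -> h y.

(* Along the orbit path p_0, p_1, ... of x0 to y0, the points n_(i+1) = med n_i p_(i+1) y0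
   advance monotonically towards y0, and every halfspace crossed from n_i to n_(i+1) is
   crossed from p_i to p_(i+1). *)
Lemma monotone_path g : in_group S g -> forall f f' n,
  in_group S f -> in_group S f' -> inverse f f' -> f (g x0) = y0 ->
  (forall h, halfspace d h -> h y0 -> ~ h n -> ~ h (f x0)) ->
  exists l, d n y0 <= sum (fun t => d (start t) (stop t)) l /\
    (forall t, In t l -> good_step t /\ before n (start t)) /\
    StronglySorted (fun t u => before (stop t) (start u)) l.
Proof.
  (* The induction step common to generators and their inverses: one edge from [f x0] to [f (s x0)],
     then a path for [f] composed with [s]. *)
  assert (K : forall s s' e, In s generators -> in_group S s -> in_group S s' -> inverse s s' ->
    (forall f f' n, in_group S f -> in_group S f' -> inverse f f' -> f (e x0) = y0 ->
      (forall h, halfspace d h -> h y0 -> ~ h n -> ~ h (f x0)) ->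
      exists l, d n y0 <= sum (fun t => d (start t) (stop t)) l /\
        (forall t, In t l -> good_step t /\ before n (start t)) /\
        StronglySorted (fun t u => before (stop t) (start u)) l) ->
    forall f f' n, in_group S f -> in_group S f' -> inverse f f' -> f (s (e x0)) = y0 ->
      (forall h, halfspace d h -> h y0 -> ~ h n -> ~ h (f x0)) ->
      exists l, d n y0 <= sum (fun t => d (start t) (stop t)) l /\
        (forall t, In t l -> good_step t /\ before n (start t)) /\
        StronglySorted (fun t u => before (stop t) (start u)) l).
  { intros s s' e Is Hs Hs' [Is1 Is2] IH f f' n Hf Hf' [If1 If2] Hy Hn.
    set (n' := med n (f (s x0)) y0).
    destruct (IH (fun x => f (s x)) (fun x => s' (f' x)) n') as [l [L1 [L2 L3]]];
      auto using in_group_comp.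
    { split; intros x; [now rewrite If1, Is1|now rewrite Is2, If2]. }
    { intros h Hh Hy0; unfold n'; rewrite halfspace_med by auto; tauto. }
    exists (Step f f' s n n' :: l); split; [|split].
    - simpl; pose proof (dtri n n' y0); lra.
    - intros t [<-|Ht].
      + split; [|intros h _ _ Hh; exact Hh].
        split; [|split; [|split; [|split]]]; auto; [now split|].
        intros h Hh; simpl; unfold n'; rewrite halfspace_med by auto.
        specialize (Hn h Hh); tauto.
      + destruct (L2 t Ht) as [G B]; split; auto.
        intros h Hh Hy0 Hhn; apply B; auto; unfold n'; rewrite halfspace_med by auto; tauto.
    - constructor; auto; apply Forall_forall; intros t Ht; apply L2, Ht. }
  induction 1 as [|p g Hp Hg IH|p g Hp Hg IH]; intros f f' n Hf Hf' If Hy Hn.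
  - exists nil; split; [|split; [easy|constructor]].
    replace n with y0; [rewrite dxx; simpl; lra|].
    apply halfspace_ext; intros h Hh Hy0; apply NNPP; intros N.
    now apply (Hn h Hh Hy0 N); rewrite Hy.
  - destruct (Hgen p Hp) as [_ [_ [J1 J2]]].
    apply (K (fst p) (snd p) g) with f f'; auto using in_group_fst, in_group_snd; [|now split].
    apply in_app_iff; left; now apply in_map.
  - destruct (Hgen p Hp) as [_ [_ [J1 J2]]].
    apply (K (snd p) (fst p) g) with f f'; auto using in_group_fst, in_group_snd; [|now split].
    apply in_app_iff; right; now apply in_map.
Qed.

(* The translates of h crossed at different steps are distinct halfspaces containing y0 but
   not x0, so two non-transverse ones would be strictly nested. *)
Lemma crossing_bound l h : no_skewer -> halfspace d h ->
  (forall t, In t l -> good_step t /\ before x0 (start t)) ->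
  StronglySorted (fun t u => before (stop t) (start u)) l ->
  sum (fun t => ind (~ h (pos' t (start t)) /\ h (pos' t (stop t)))) l <= INR r.
Proof.
  intros NS Hh Hl Hs.
  rewrite (sum_ind (fun t => ~ h (pos' t (start t)) /\ h (pos' t (stop t)))); apply le_INR.
  set (q := filter _ l).
  assert (Hq : forall t, In t q -> In t l /\ ~ h (pos' t (start t)) /\ h (pos' t (stop t))).
  { intros t Ht; apply filter_In in Ht; now rewrite decb_true in Ht. }
  assert (Sq := StronglySorted_filter _ _ _ Hs : StronglySorted _ q).
  clearbody q.
  assert (t0 : step) by exact (Step (fun x => x) (fun x => x) (fun x => x) x0 x0).
  assert (Hk : forall t, In t q -> halfspace d (fun x => h (pos' t x))).
  { intros t Ht; destruct (Hl t (proj1 (Hq t Ht))) as [[G1 [G2 [[I1 I2] _]]] _].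
    apply (halfspace_comp (pos' t) (pos t)); auto using in_group_isometry. }
  assert (Tr : forall i j, (i < j < length q)%nat ->
    transverse (fun x => h (pos' (nth i q t0) x)) (fun x => h (pos' (nth j q t0) x))).
  { intros i j Hij.
    assert (B := StronglySorted_nth _ q t0 Sq i j Hij).
    assert (It : In (nth i q t0) q) by (apply nth_In; lia).
    assert (Iu : In (nth j q t0) q) by (apply nth_In; lia).
    set (t := nth i q t0) in *; set (u := nth j q t0) in *; simpl in B.
    assert (Kt := Hk t It); assert (Ku := Hk u Iu).
    destruct (Hq t It) as [Lt [Nt Pt]], (Hq u Iu) as [Lu [Nu Pu]].
    destruct (Hl t Lt) as [[Gt [Gt' [[It1 It2] [_ Ct]]]] Bt].
    destruct (Hl u Lu) as [[Gu [Gu' [[Iu1 Iu2] [_ Cu]]]] Bu].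
    destruct (Ct _ Kt Nt Pt) as [Yt _], (Cu _ Ku Nu Pu) as [Yu _].
    split; [exists y0; auto|split; [|split]].
    - exists (stop t); split; auto; intros H; apply Nu, (B _ Ku); auto.
    (* [pos u] after [pos' t] carries the translate at [t] to the one at [u]. Were the latter
       contained in the former, [no_skewer] would make them equal, but only the translate at [t]
       contains [stop t]. *)
    - apply NNPP; intros N.
      assert (Sub : forall x, h (pos' u x) -> h (pos' t x)).
      { intros x Hx; apply NNPP; intros Nx; apply N; exists x; split; auto. }
      apply Nu, (B _ Ku); auto.
      rewrite <- (It1 (pos' u (stop t))).
      apply (NS (fun x => pos u (pos' t x)) (fun x => pos t (pos' u x))
               (fun x => h (pos' t x))); auto using in_group_comp.
      + split; intros x; [now rewrite Iu1, It2|now rewrite It1, Iu2].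
      + intros x; rewrite It1; auto.
    - exists x0; split; intros H; [apply Nt, (Bt _ Kt)|apply Nu, (Bu _ Ku)]; auto. }
  apply (Hrank (length q) (fun i x => h (pos' (nth i q t0) x))).
  - intros i Hi; apply Hk, nth_In, Hi.
  - intros i j Hi Hj Hij; destruct (Nat.lt_total i j) as [L|[L|L]]; [|lia|].
    + apply Tr; lia.
    + apply transverse_sym, Tr; lia.
Qed.

End Path.

(** Steps are grouped by generator [s]. Pulled back by [pos'], those of one group lie between [x0]
    and [s x0], and each halfspace is crossed by at most [r] of them, so their total length is at
    most [r] times [d x0 (s x0)], independently of [g]. *)
Lemma orbit_bounded x0 : no_skewer ->
  exists M, forall g, in_group S g -> d x0 (g x0) <= M.
Proof.
  intros NS; exists (sum (fun s => INR r * d x0 (s x0)) generators); intros g Hg.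
  set (y0 := g x0).
  destruct (monotone_path x0 y0 g Hg (fun x => x) (fun x => x) x0) as [l [L1 [L2 L3]]]; auto.
  { constructor. }
  { constructor. }
  { now split. }
  apply Rle_trans with (1 := L1).
  apply Rle_trans with (1 := sum_classes gen (fun t => d (start t) (stop t)) l generators
    (fun t _ => dpos _ _) (fun t Ht => proj1 (proj2 (proj2 (proj2 (proj1 (L2 t Ht))))))).
  apply sum_le; intros s Hs.
  set (q := filter _ l).
  assert (Hq : forall t, In t q -> In t l /\ gen t = s).
  { intros t Ht; apply filter_In in Ht; now rewrite decb_true in Ht. }
  assert (Sq := StronglySorted_filter _ _ _ L3 : StronglySorted _ q).
  clearbody q.
  apply Rle_trans with (sum (fun t => d (pos' t (start t)) (pos' t (stop t))) q).
  { apply sum_le; intros t Ht; destruct (L2 t (proj1 (Hq t Ht))) as [[_ [G _]] _].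
    rewrite (in_group_isometry _ G); lra. }
  apply sum_dist_le_multiplicity.
  - intros t Ht h Hh Hb Ha; destruct (Hq t Ht) as [Lt <-].
    destruct (L2 t Lt) as [[G [G' [[I1 I2] [_ C]]]] _].
    destruct (C (fun x => h (pos' t x))) as [_ [C1 C2]]; auto.
    + apply (halfspace_comp (pos' t) (pos t)); auto using in_group_isometry.
    + rewrite I1 in C1, C2; auto.
  - intros h Hh; apply (crossing_bound x0 y0); auto; intros t Ht; apply L2, Hq, Ht.
Qed.

(** * Minimal invariant sets *)

Definition invariant (C : X -> Prop) : Prop := forall g, in_group S g -> forall x, C x -> C (g x).
Definition invariant_closed_convex (C : X -> Prop) : Prop :=
  closed C /\ convex d C /\ (exists x, C x) /\ invariant C.

Lemma closure_comp f (C D : X -> Prop) x : isometry d f ->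
  (forall y, C y -> D (f y)) -> closure C x -> closure D (f x).
Proof.
  intros Hf HCD Hx eps He; destruct (Hx eps He) as [v [Cv Hv]].
  exists (f v); rewrite Hf; auto.
Qed.

Lemma closed_comp f C : isometry d f -> closed C -> closed (fun x => C (f x)).
Proof. intros Hf HC x Hx; apply HC, closure_comp with (3 := Hx); auto. Qed.

Lemma convex_comp f C : isometry d f -> convex d C -> convex d (fun x => C (f x)).
Proof.
  intros Hf HC x y Hx Hy z Hz; apply (HC (f x) (f y)); auto; unfold interval; now rewrite !Hf.
Qed.

(** The set is the closed convex hull of the orbit, which stays near the convex set formed by [x0]
    alone. *)
Lemma bounded_invariant x0 M : (forall g, in_group S g -> d x0 (g x0) <= M) ->
  exists C B, invariant_closed_convex C /\ forall x, C x -> d x0 x <= B.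
Proof.
  intros HM; set (O := fun x => exists g, in_group S g /\ x = g x0).
  (* [Rabs M + 1] strictly exceeds the distances from [x0] to its orbit; the last 1 pays for the
     closure. *)
  exists (closure (conv O)), (INR (r + 2) * (Rabs M + 1) + 1); split.
  - split; [apply closure_closed|split; [apply closure_convex, conv_convex|split]].
    + exists x0; apply closure_sub, conv_in; exists (fun x => x); split; auto; constructor.
    + intros g Hg x; apply closure_comp; auto using in_group_isometry.
      destruct (in_group_inverse g Hg) as [g' [Hg' [I1 I2]]].
      intros y [l [Hl [Ol Hy]]]; exists (map g l); split; [|split].
      * destruct l; easy.
      * intros a Ha; apply in_map_iff in Ha; destruct Ha as [b [<- Hb]].
        destruct (Ol b Hb) as [f [Hf ->]]; exists (fun x => g (f x)); auto using in_group_comp.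
      * intros h Hh Hin; apply (Hy (fun x => h (g x))).
        -- apply (halfspace_comp g g'); auto using in_group_isometry.
        -- intros a Ha; now apply Hin, in_map.
  - intros x Hx; destruct (Hx 1 Rlt_0_1) as [v [Cv Hv]].
    destruct (conv_near O (eq x0) (Rabs M + 1) v) as [c [<- Hc]]; auto using singleton_convex.
    + pose proof (Rabs_pos M); lra.
    + intros a [g [Hg ->]]; exists x0; split; auto; rewrite dsym.
      pose proof (HM g Hg); pose proof (Rle_abs M); lra.
    + dsat; pose proof (dtri x0 v x); lra.
Qed.

(** Zorn's lemma for reverse inclusion; the bound [B] keeps the intersection of a nonempty chain
    nonempty. *)
Lemma minimal_invariant C0 x0 B :
  invariant_closed_convex C0 -> (forall x, C0 x -> d x0 x <= B) ->
  exists C, invariant_closed_convex C /\ (forall x, C x -> C0 x) /\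
    forall D, invariant_closed_convex D -> (forall x, D x -> C x) -> forall x, C x -> D x.
Proof.
  intros H0 HB.
  set (T := {C | invariant_closed_convex C /\ forall x, C x -> C0 x}).
  assert (t0 : T) by (exists C0; auto).
  destruct (zorn T (fun P Q => forall x, proj1_sig Q x -> proj1_sig P x) t0)
    as [[C [HC HC0]] Hmin]; simpl in *; auto.
  - intros F HF; destruct (classic (exists P, F P)) as [[P0 FP0]|N].
    2: { exists t0; intros P FP; destruct N; eauto. }
    destruct (directed_inter (fun A => exists P, F P /\ A = proj1_sig P) x0 B) as [c Hc].
    + eauto.
    + intros A [P [FP ->]]; destruct P as [P [[P1 [P2 [[p Pp] P4]]] P5]]; simpl; eauto 7.
    + intros A A' [P [FP ->]] [Q [FQ ->]]; destruct (HF P Q FP FQ) as [H|H]; eauto 7.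
    + unshelve eexists (exist _ (fun x => forall P, F P -> proj1_sig P x) _); [split|].
      * split; [|split; [|split]].
        -- intros x Hx P FP; assert (Hx' : closure (proj1_sig P) x)
             by (apply closure_mono with (2 := Hx); auto).
           destruct P as [P [[P1 ?] ?]]; now apply P1.
        -- intros x y Hx Hy z Hz P FP; specialize (Hx P FP); specialize (Hy P FP).
           destruct P as [P [[P1 [P2 ?]] ?]]; exact (P2 x y Hx Hy z Hz).
        -- exists c; intros P FP; apply Hc; eauto.
        -- intros g Hg x Hx P FP; specialize (Hx P FP).
           destruct P as [P [[P1 [P2 [P3 P4]]] ?]]; exact (P4 g Hg x Hx).
      * intros x Hx; specialize (Hx P0 FP0); destruct P0 as [P0 [? P5]]; now apply P5.
      * simpl; auto.
  - exists C; split; [exact HC|split; [exact HC0|]]; intros D HD HDC.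
    assert (HD0 : invariant_closed_convex D /\ forall x, D x -> C0 x) by auto.
    exact (Hmin (exist _ D HD0) HDC).
Qed.

(** * Halfspaces cutting a minimal invariant set *)

Section Minimal.
Hypothesis NS : no_skewer.
Variables (C : X -> Prop) (x0 : X) (B : R).
Hypothesis HC : invariant_closed_convex C.
Hypothesis HB : forall x, C x -> d x0 x <= B.
Hypothesis Hmin : forall D, invariant_closed_convex D -> (forall x, D x -> C x) ->
  forall x, C x -> D x.
Variable proj : X -> X.
Hypothesis Hproj : forall x, C (proj x) /\ forall p, C p -> interval d x p (proj x).

Lemma proj_id x : C x -> proj x = x.
Proof. intros Cx; apply interval_id, Hproj, Cx. Qed.

Lemma proj_equivariant g x : in_group S g -> proj (g x) = g (proj x).
Proof.
  intros Hg; destruct (in_group_inverse g Hg) as [g' [Hg' [I1 I2]]].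
  destruct HC as [_ [_ [_ inv]]].
  apply interval_anti with (g x).
  - destruct (Hproj x) as [_ H]; specialize (H (g' (proj (g x)))).
    assert (H' := H (inv g' Hg' _ (proj1 (Hproj (g x))))).
    unfold interval in *; pose proof (in_group_isometry g Hg) as iso.
    rewrite <- (iso x (proj x)), <- (iso (proj x)), <- (iso x (g' _)), !I2 in H'; exact H'.
  - apply Hproj, inv, Hproj; auto.
Qed.

(** By the gate property, a halfspace containing [proj x] and [proj y] but not [proj z] would
    contain [x] and [y] but not [z]. *)
Lemma proj_interval x y z : interval d x y z -> interval d (proj x) (proj y) (proj z).
Proof.
  intros Hz; apply interval_halfspace; intros h Hh hx hy; apply NNPP; intros nz.
  pose proof (halfspace_compl h Hh) as Hh'.
  assert (N : ~ h z).
  { intros hz; apply nz, (halfspace_interval h z (proj x)); auto; apply Hproj, Hproj. }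
  assert (K : forall u, h (proj u) -> h u).
  { intros u hu; apply NNPP; intros nu.
    apply (halfspace_interval _ u (proj z) (proj u) Hh'); auto; apply Hproj, Hproj. }
  apply N, (halfspace_interval h x y); auto.
Qed.

Lemma proj_lipschitz x y : d (proj x) (proj y) <= d x y.
Proof.
  pose proof (proj2 (Hproj x) _ (proj1 (Hproj y))).
  pose proof (proj2 (Hproj y) _ (proj1 (Hproj x))).
  dsat; pose proof (dtri x y (proj y)); pose proof (dtri y x (proj x)); lra.
Qed.

(** A halfspace of [C] with interior on both sides, encoded as its preimage under [proj]: this is a
    halfspace of [X] determined by its trace on [C]. *)
Definition thick (k : X -> Prop) : Prop :=
  halfspace d k /\ (forall x, k x <-> k (proj x)) /\
  (exists p eps, C p /\ 0 < eps /\ forall v, C v -> d p v < eps -> k v) /\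
  (exists q eps, C q /\ 0 < eps /\ forall v, C v -> d q v < eps -> ~ k v).

Lemma thick_compl k : thick k -> thick (fun x => ~ k x).
Proof.
  intros [H1 [H2 [[p [e [Cp [He Hp]]]] H4]]]; split; [|split; [|split]]; auto using halfspace_compl.
  - intros x; now rewrite (H2 x) at 1.
  - exists p, e; split; [|split]; auto; intros v Cv Hv N; exact (N (Hp v Cv Hv)).
Qed.

Lemma thick_exists p q : C p -> C q -> p <> q -> exists k, thick k /\ k p /\ ~ k q.
Proof.
  intros Cp Cq N.
  destruct (thick_separation (eq p) (eq q) (d p q)) as [h [eps [Hh [He [h1 h2]]]]];
    eauto using singleton_convex.
  { destruct (dpos p q) as [H|H]; auto; symmetry in H; apply deq0 in H; congruence. }
  { intros a b <- <-; lra. }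
  assert (hp : h p) by (apply (h1 p); auto; now rewrite dxx).
  assert (hq : ~ h q) by (apply (h2 q); auto; now rewrite dxx).
  exists (fun x => h (proj x)); rewrite !proj_id by auto; split; auto.
  split; [split; [|split; [|split]]|split; [|split]].
  - exists p; now rewrite proj_id.
  - exists q; now rewrite proj_id.
  - intros x y Hx Hy z Hz; apply (halfspace_interval h (proj x) (proj y)); auto using proj_interval.
  - intros x y Hx Hy z Hz.
    apply (halfspace_interval _ (proj x) (proj y) (proj z) (halfspace_compl h Hh));
      auto using proj_interval.
  - intros x; now rewrite (proj_id (proj x)) by apply Hproj.
  - exists p, eps; split; [|split]; auto; intros v Cv Hv; rewrite proj_id by auto; eauto.
  - exists q, eps; split; [|split]; auto; intros v Cv Hv; rewrite proj_id by auto; eauto.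
Qed.

(* Otherwise all translates of the closure of k in C meet pairwise, and their intersection,
   nonempty by Helly, would be a smaller invariant set. *)
Lemma thick_disjoint_translate k : thick k -> exists g g',
  in_group S g /\ in_group S g' /\ inverse g g' /\ (forall x, k x -> ~ k (g' x)) /\
  forall x, k x -> exists eps, 0 < eps /\ forall v, C v -> d (proj x) v < eps -> ~ k (g' v).
Proof.
  intros [Hk [Kp [[p [ep [Cp [Hep Np]]]] [q [eta [Cq [Heta Nq]]]]]]].
  destruct HC as [clC [cC [neC inv]]].
  set (D := fun v => C v /\ k v); set (E := closure D).
  assert (clE : closed E) by apply closure_closed.
  assert (cE : convex d E) by (apply closure_convex, convex_and; auto; apply Hk).
  assert (Ep : E p) by (apply closure_sub; split; auto; apply Np; auto; now rewrite dxx).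
  assert (EC : forall x, E x -> C x)
    by (intros x Hx; apply clC, closure_mono with (2 := Hx); now intros y []).
  assert (nEq : ~ E q).
  { intros H; destruct (H eta Heta) as [v [[Cv kv] Hv]]; exact (Nq v Cv Hv kv). }
  assert (F : exists g g', in_group S g /\ in_group S g' /\ inverse g g' /\
    forall x, E x -> ~ E (g' x)).
  { apply NNPP; intros N.
    assert (meet : forall f1 f2, in_group S f1 -> in_group S f2 -> exists x, E (f1 x) /\ E (f2 x)).
    { intros f1 f2 H1 H2.
      destruct (in_group_inverse f1 H1) as [f1' [H1' [I1 J1]]].
      destruct (in_group_inverse f2 H2) as [f2' [H2' [I2 J2]]].
      apply NNPP; intros N'; apply N.
      exists (fun x => f1 (f2' x)), (fun x => f2 (f1' x)).
      split; [now apply in_group_comp|split; [now apply in_group_comp|split]].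
      - split; intros x; [now rewrite I1, J2|now rewrite I2, J1].
      - intros x Ex Ex'; apply N'; exists (f1' x); rewrite J1; auto. }
    assert (iso := in_group_isometry).
    destruct (directed_inter (fun A => exists l, (forall f, In f l -> in_group S f) /\
        A = fun x => C x /\ forall f, In f l -> E (f x)) x0 B) as [c Hc].
    - exists (fun x => C x /\ forall f, In f nil -> E (f x)), nil; split; easy.
    - intros A [l [Hl ->]]; split; [|split].
      + intros x Hx; split.
        * apply clC, closure_mono with (2 := Hx); now intros y [].
        * intros f Hf; apply (closed_comp f E); auto.
          apply closure_mono with (2 := Hx); intros y [_ Hy]; auto.
      + intros x y [Cx Hx] [Cy Hy] z Hz; split; [exact (cC x y Cx Cy z Hz)|].
        intros f Hf; apply (convex_comp f E (iso f (Hl f Hf)) cE x y); auto.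
      + destruct (helly (map (fun f x => E (f x)) l) C) as [x [Cx Hx]]; auto.
        * intros A HA; apply in_map_iff in HA; destruct HA as [f [<- Hf]].
          now apply convex_comp; auto.
        * intros A HA; apply in_map_iff in HA; destruct HA as [f [<- Hf]].
          destruct (in_group_inverse f (Hl f Hf)) as [f' [Hf' [I J]]].
          exists (f' p); rewrite J; auto.
        * intros A A' HA HA'; apply in_map_iff in HA, HA'.
          destruct HA as [f [<- Hf]], HA' as [f' [<- Hf']]; auto.
        * exists x; split; [split|]; auto.
          intros f Hf; apply (Hx (fun x => E (f x))), in_map_iff; eauto.
    - intros A A' [l [Hl ->]] [l' [Hl' ->]].
      eexists; split; [exists (l ++ l'); split; [|reflexivity]|].
      + intros f Hf; apply in_app_iff in Hf; destruct Hf; auto.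
      + intros x [Cx Hx]; split; split; auto; intros f Hf; apply Hx, in_app_iff; auto.
    - assert (Hc' : forall f, in_group S f -> C c /\ E (f c)).
      { intros f Hf.
        destruct (Hc (fun x => C x /\ forall g, In g (f :: nil) -> E (g x))) as [H1 H2].
        - exists (f :: nil); split; auto; now intros g [<-|[]].
        - split; auto; apply H2; simpl; auto. }
      set (D' := fun x => C x /\ forall f, in_group S f -> E (f x)).
      assert (HD : invariant_closed_convex D').
      { split; [|split; [|split]].
        + intros x Hx; split.
          * apply clC, closure_mono with (2 := Hx); now intros y [].
          * intros f Hf; apply (closed_comp f E); auto.
            apply closure_mono with (2 := Hx); intros y [_ Hy]; auto.
        + intros x y [Cx Hx] [Cy Hy] z Hz; split; [exact (cC x y Cx Cy z Hz)|].
          intros f Hf; apply (convex_comp f E (iso f Hf) cE x y); auto.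
        + exists c; split; [|intros f Hf; now apply Hc'].
          apply (Hc' (fun x => x)); constructor.
        + intros g Hg x [Cx Hx]; split; [now apply inv|].
          intros f Hf; apply (Hx (fun y => f (g y))), in_group_comp; auto. }
      (* By minimality [D'] is all of [C], so [q] would lie in [E]. *)
      exact (nEq (proj2 (Hmin D' HD (fun x H => proj1 H) q Cq) _ (in_group_id X S))). }
  destruct F as [g [g' [Hg [Hg' [I HE]]]]].
  exists g, g'; do 3 (split; auto).
  assert (kE : forall x, k x -> E (proj x)).
  { intros x kx; apply closure_sub; split; [apply Hproj|exact (proj1 (Kp x) kx)]. }
  split.
  - intros x kx kx'; apply (HE (proj x)); auto.
    rewrite <- proj_equivariant by auto; auto.
  (* [E] is a closure, so a point outside it is at positive distance from [D]. *)
  - intros x kx; assert (N := HE _ (kE x kx)).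
    apply not_all_ex_not in N; destruct N as [eps N]; apply imply_to_and in N.
    destruct N as [He N]; exists eps; split; auto.
    intros v Cv Hv kv; apply N; exists (g' v); split; [split; auto|].
    now rewrite in_group_isometry.
Qed.

(** [g1'] maps [k] into its complement and [g2'] maps the complement into [k]. Their composite maps
    [k] into itself, hence onto itself by [no_skewer], so [g1'] exchanges the two sides. *)
Lemma thick_flip k : thick k -> exists f, in_group S f /\ (forall x, k (f x) <-> ~ k x) /\
  forall x, k x -> exists eps, 0 < eps /\ forall v, C v -> d (proj x) v < eps -> k v.
Proof.
  intros Tk.
  destruct (thick_disjoint_translate k Tk) as [g1 [g1' [G1 [G1' [[I1 J1] [D1 O1]]]]]].
  destruct (thick_disjoint_translate _ (thick_compl k Tk)) as [g2 [g2' [G2 [G2' [[I2 J2] [D2 _]]]]]].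
  assert (D2' : forall x, ~ k x -> k (g2' x)) by (intros x Hx; now apply NNPP, D2).
  assert (Q : forall x, k x -> k (g1 (g2 x))).
  { apply (NS (fun x => g2' (g1' x)) (fun x => g1 (g2 x))); auto using in_group_comp.
    - split; intros x; [now rewrite J2, J1|now rewrite I1, I2].
    - apply Tk.
    - intros x Hx; apply D1 in Hx; rewrite I1 in Hx; apply D2' in Hx; now rewrite I2 in Hx. }
  assert (fl : forall x, k (g1' x) <-> ~ k x).
  { intros x; split; [intros H H'; exact (D1 x H' H)|].
    intros H; apply NNPP; intros H'; apply H; apply D2', Q in H'; now rewrite J2, J1 in H'. }
  exists g1'; split; [|split]; auto; intros x kx.
  destruct (O1 x kx) as [eps [He Ho]]; exists eps; split; auto; intros v Cv Hv.
  apply NNPP; intros N; apply (Ho v Cv Hv), fl, N.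
Qed.

(** With [f] flipping [h] and [g] flipping [k], the product of [f] and [g] maps [k] into [h]. In
    particular it maps [h] into itself, hence onto itself by [no_skewer], so [k] is no larger than
    [h]. *)
Lemma thick_nested h k : thick h -> thick k -> (forall x, h x -> k x) -> forall x, k x -> h x.
Proof.
  intros Th Tk Hhk x kx.
  destruct (thick_flip h Th) as [f [Hf [Fh _]]], (thick_flip k Tk) as [g [Hg [Fk _]]].
  destruct (in_group_inverse f Hf) as [f' [Hf' [I1 J1]]].
  destruct (in_group_inverse g Hg) as [g' [Hg' [I2 J2]]].
  assert (P : forall x, k x -> h (f (g x))).
  { intros y ky; apply Fh; intros H; apply Hhk, Fk in H; auto. }
  assert (Q : forall x, h x -> h (g' (f' x))).
  { apply (NS (fun x => f (g x)) (fun x => g' (f' x))); auto using in_group_comp.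
    - split; intros y; [now rewrite I1, I2|now rewrite J2, J1].
    - apply Th.
    - intros y Hy; apply Hhk, P in Hy; now rewrite J2, J1 in Hy. }
  specialize (Q _ (P x kx)); now rewrite I1, I2 in Q.
Qed.

Lemma thick_trichotomy h k : thick h -> thick k ->
  transverse h k \/ (forall x, k x <-> h x) \/ (forall x, k x <-> ~ h x).
Proof.
  intros Th Tk; pose proof (thick_compl h Th) as Th'; pose proof (thick_compl k Tk) as Tk'.
  apply NNPP; intros N.
  assert (N1 : ~ (forall x, k x <-> h x)) by tauto.
  assert (N2 : ~ (forall x, k x <-> ~ h x)) by tauto.
  apply N; left; unfold transverse, compl.
  split; [|split; [|split]]; apply NNPP; intros M.
  - assert (S1 : forall x, h x -> ~ k x) by (intros x H1 H2; apply M; eauto).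
    pose proof (thick_nested _ _ Th Tk' S1).
    apply N2; intros x; specialize (S1 x); specialize (H x); simpl in *; tauto.
  - assert (S1 : forall x, h x -> k x) by (intros x H1; apply NNPP; intros H2; apply M; eauto).
    pose proof (thick_nested _ _ Th Tk S1); apply N1; intros x; split; auto.
  - assert (S1 : forall x, k x -> h x) by (intros x H1; apply NNPP; intros H2; apply M; eauto).
    pose proof (thick_nested _ _ Tk Th S1); apply N1; intros x; split; auto.
  - assert (S1 : forall x, ~ h x -> k x) by (intros x H1; apply NNPP; intros H2; apply M; eauto).
    pose proof (thick_nested _ _ Th' Tk S1); apply N2; intros x; split; auto.
Qed.

(** A pairwise transverse family is enlarged until every thick halfspace is a member or the
    complement of one; [n] bounds the enlargements left, as the rank forbids more than [r]
    members. *)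
Lemma thick_family n : forall m (H : nat -> X -> Prop), (r <= m + n)%nat ->
  (forall i, (i < m)%nat -> thick (H i)) ->
  (forall i j, (i < m)%nat -> (j < m)%nat -> i <> j -> transverse (H i) (H j)) ->
  exists L : list (X -> Prop), forall k, thick k ->
    exists h, In h L /\ ((forall x, k x <-> h x) \/ (forall x, k x <-> ~ h x)).
Proof.
  induction n as [|n IH]; intros m H Hm HT Htr;
  (destruct (classic (forall k, thick k -> exists i, (i < m)%nat /\
      ((forall x, k x <-> H i x) \/ (forall x, k x <-> ~ H i x)))) as [A|A];
   [exists (map H (seq 0 m)); intros k Tk; destruct (A k Tk) as [i [Hi Ha]];
    exists (H i); split; auto; apply in_map, in_seq; lia|
    apply not_all_ex_not in A; destruct A as [k A]; apply imply_to_and in A;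
    destruct A as [Tk A];
    set (H' := fun i => if Nat.eqb i m then k else H i);
    assert (HT' : forall i, (i < Datatypes.S m)%nat -> thick (H' i)) by
      (intros i Hi; unfold H'; destruct (Nat.eqb_spec i m); auto; apply HT; lia);
    assert (Tr : forall i, (i < m)%nat -> transverse (H i) k) by
      (intros i Hi; destruct (thick_trichotomy (H i) k (HT i Hi) Tk); auto;
       destruct A; exists i; auto);
    assert (Htr' : forall i j, (i < Datatypes.S m)%nat -> (j < Datatypes.S m)%nat -> i <> j ->
      transverse (H' i) (H' j)) by
      (intros i j Hi Hj Hij; unfold H';
       destruct (Nat.eqb_spec i m), (Nat.eqb_spec j m); [lia| | |];
       [apply transverse_sym, Tr; lia|apply Tr; lia|apply Htr; lia])]).
  - assert (Datatypes.S m <= r)%nat; [|lia].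
    apply (Hrank _ H'); auto; intros i Hi; apply (HT' i Hi).
  - apply (IH (Datatypes.S m) H'); auto; lia.
Qed.

(** Each member of [L] cuts [A] in two; after all cuts every part has at most one point. *)
Lemma finite_of_signatures (L : list (X -> Prop)) : forall A : X -> Prop,
  (forall p q, A p -> A q -> (forall h, In h L -> (h p <-> h q)) -> p = q) ->
  exists l, forall c, A c -> In c l.
Proof.
  induction L as [|h L IH]; intros A HA.
  - destruct (classic (exists c, A c)) as [[c Ac]|N].
    + exists (c :: nil); intros c' Ac'; left; apply HA; auto; easy.
    + exists nil; intros c Ac; apply N; eauto.
  - destruct (IH (fun x => A x /\ h x)) as [l Hl].
    { intros p q [Ap hp] [Aq hq] Hpq; apply HA; auto; intros k [<-|Hk]; [tauto|auto]. }
    destruct (IH (fun x => A x /\ ~ h x)) as [l' Hl'].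
    { intros p q [Ap hp] [Aq hq] Hpq; apply HA; auto; intros k [<-|Hk]; [tauto|auto]. }
    exists (l ++ l'); intros c Ac; apply in_app_iff; destruct (classic (h c)); auto.
Qed.

Lemma minimal_finite : exists l, forall c, C c -> In c l.
Proof.
  destruct (thick_family r 0 (fun _ _ => True)) as [L HL]; try (intros; lia).
  apply (finite_of_signatures L C); intros p q Cp Cq Hpq; apply NNPP; intros N.
  destruct (thick_exists p q Cp Cq N) as [k [Tk [kp kq]]].
  destruct (HL k Tk) as [h [hL [E|E]]]; specialize (Hpq h hL);
    pose proof (E p); pose proof (E q); tauto.
Qed.

(** Connectedness is assumed for [X], so the neighbourhood in [C] from [thick_flip] is pulled back
    by the 1-Lipschitz [proj]. *)
Lemma thick_open k : thick k -> Defs.open_set X d k.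
Proof.
  intros Tk x kx; destruct (thick_flip k Tk) as [_ [_ [_ O]]].
  destruct (O x kx) as [eps [He Ho]]; exists eps; split; auto; intros y Hy.
  apply Tk, Ho; [apply Hproj|]; pose proof (proj_lipschitz x y); lra.
Qed.

Lemma minimal_connected p q : connected d -> C p -> C q -> p = q.
Proof.
  intros Hcon Cp Cq; apply NNPP; intros N.
  destruct (thick_exists p q Cp Cq N) as [k [Tk [kp kq]]].
  destruct (Hcon k) as [H|H]; [now apply thick_open|exact (thick_open _ (thick_compl k Tk))| |].
  - apply kq, H.
  - exact (H p kp).
Qed.

End Minimal.

End MedianSpace.

(** * Finite orbits and global fixed points *)

Theorem theorem3p1 (X : Type) (d : X -> X -> R) (x0 : X)
  (Hmed : median_space d) (Hcomp : complete d) (Hrank : finite_rank d)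
  (S : list ((X -> X) * (X -> X)))
  (Hgen : forall p, In p S -> good_generator d p)
  (Hell : forall g, in_group S g -> elliptic d g) :
  (exists x, finite_orbit S x) /\
  (connected d -> exists x, forall g, in_group S g -> g x = x).
Proof.
  destruct Hrank as [r Hr].
  assert (NS : no_skewer X d S).
  { intros g g' k Hg Hg' [I1 I2]; apply (elliptic_no_skewer X d Hmed Hcomp r Hr g g'); auto.
    exact (in_group_isometry X d S Hgen g' Hg'). }
  destruct (orbit_bounded X d Hmed r Hr S Hgen x0 NS) as [M HM].
  destruct (bounded_invariant X d Hmed r Hr S Hgen x0 M HM) as [C0 [B [HC0 HB0]]].
  destruct (minimal_invariant X d Hmed Hcomp S C0 x0 B HC0 HB0) as [C [HC [HCC0 Hmin]]].
  assert (HB : forall x, C x -> d x0 x <= B) by auto.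
  pose proof HC as [clC [cC [[c Cc] inv]]].
  destruct (choice (fun x c => C c /\ forall p, C p -> interval d x p c)) as [proj Hproj].
  { intros x; apply (gate_exists X d Hmed Hcomp); eauto. }
  split.
  - destruct (minimal_finite X d Hmed Hcomp r Hr S Hgen NS C x0 B HC HB Hmin proj Hproj) as [l Hl].
    (* The orbit of [c] stays in the finite set [C]. *)
    exists c, l; intros g Hg; apply Hl, inv; auto.
  - intros Hcon; exists c; intros g Hg.
    apply (minimal_connected X d Hmed Hcomp r Hr S Hgen NS C x0 B HC HB Hmin proj Hproj); auto.
Qed.
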